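(* Let $q>0$, $q\neq1$, let $\lambda=(\lambda_1\ge\cdots\ge\lambda_N)$ be a signature of size $N$, and let $x\in\mathbb C$ be other than $0$ and $q^i$, $i\in\{0,\dots,N-2\}$. Then $$S_\lambda(x;N,q)=\frac{[N-1]_q!\;q^{\binom{N-1}{2}}(q-1)^{N-1}}{\prod_{i=1}^{N-1}(x-q^{i-1})}\cdot\frac{\ln(q)}{2\pi\mathbf{i}}\oint_C\frac{x^zq^z}{\prod_{i=1}^N\bigl(q^z-q^{\lambda_i+N-i}\bigr)}\,dz,$$ where the (positively oriented) contour $C$ includes the poles at $\lambda_1+N-1,\ \lambda_2+N-2,\dots,\lambda_N$ and no other poles of the integrand.
   Context: A signature of size $N$ is an $N$-tuple of integers $\lambda_1\ge\cdots\ge\lambda_N$. The rational Schur function is the symmetric Laurent polynomial $s_\lambda(u_1,\dots,u_N)=\det[u_i^{\lambda_j+N-j}]_{i,j=1}^N/\prod_{i<j}(u_i-u_j)$, and $$S_\lambda(x;N,q)=\frac{s_\lambda(x,1,q,\dots,q^{N-2})}{s_\lambda(1,q,\dots,q^{N-1})}.$$ $[m]_q=\frac{q^m-1}{q-1}$, $[a]_q!=\prod_{m=1}^a[m]_q$. $x^z=\exp(z\ln x)$ for a fixed choice of $\ln x$; $q^z=\exp(z\ln q)$ with real $\ln q$; $\mathbf{i}=\sqrt{-1}$. *)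

(* Defs.v *)
From HB Require Import structures.
From mathcomp Require Import all_boot all_order all_algebra.
From mathcomp Require Import all_classical all_reals all_analysis.
From mathcomp Require Import complex.

Set Implicit Arguments.
Unset Strict Implicit.
Unset Printing Implicit Defensive.

Import Order.TTheory GRing.Theory Num.Theory.
Import numFieldNormedType.Exports.

Local Open Scope classical_set_scope.
Local Open Scope ring_scope.
Local Open Scope complex_scope.

Definition is_signature (N : nat) (lam : 'I_N -> int) : Prop :=
  forall i j : 'I_N, (i <= j)%N -> lam j <= lam i.

(* Indices start at 0, so that the textbook $\lambda_j + N - j$, $1\le j\le N$,
   reads [lam j + (N - j.+1)]. *)
Definition shifted_part (N : nat) (lam : 'I_N -> int) (j : 'I_N) : int :=
  lam j + (N - j.+1)%N%:Z.

Section schur.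
Variable F : fieldType.

(* The bialternant formula.  It gives the value of the Laurent polynomial
   $s_\lambda$ when the [u i] are nonzero and pairwise distinct; at coinciding
   arguments the quotient is 0 (division by zero) instead. *)
Definition schur (N : nat) (lam : 'I_N -> int) (u : 'I_N -> F) : F :=
  \det (\matrix_(i < N, j < N) (u i ^ shifted_part lam j)) /
  \prod_(i < N) \prod_(j < N | (i < j)%N) (u i - u j).

Definition normalized_schur (N : nat) (lam : 'I_N -> int) (x q : F) : F :=
  schur lam (fun i => if i == 0%N :> nat then x else q ^+ i.-1) /
  schur lam (fun i => q ^+ i).

Definition qint (q : F) (m : nat) : F := (q ^+ m - 1) / (q - 1).

Definition qfact (q : F) (a : nat) : F := \prod_(1 <= m < a.+1) qint q m.

End schur.

Section complex_analysis.
Variable R : realType.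
Implicit Types (a b : R) (c : R -> R[i]) (f : R[i] -> R[i]) (p z w : R[i]).

Definition cexp z : R[i] :=
  (expR (complex.Re z) * cos (complex.Im z))
    +i* (expR (complex.Re z) * sin (complex.Im z)).

(* $w^z$ for the determination [lnw] of the logarithm of $w$. *)
Definition cpow (lnw z : R[i]) : R[i] := cexp (z * lnw).

Definition re_part c : R -> R := fun t => complex.Re (c t).
Definition im_part c : R -> R := fun t => complex.Im (c t).

(* Continuously differentiable on the closed interval [a, b]: the derivative
   on the open interval extends continuously to the end points. *)
Definition C1_segment (g : R -> R) a b : Prop :=
  derivable_oo_LRcontinuous g a b /\
  exists2 g' : R -> R, {within `[a, b], continuous g'} &
    {in `]a, b[, derive1 g =1 g'}.

(* Closed piecewise C^1 curves, parametrized by [0, 1]; [s] lists the break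
   points together with the end point 1. *)
Definition closed_contour c : Prop :=
  c 0 = c 1 /\
  exists s : seq R,
    [/\ path <%R 0 s, last 0 s = 1 &
     forall k, (k < size s)%N ->
       C1_segment (re_part c) (nth 0 (0 :: s) k) (nth 0 s k) /\
       C1_segment (im_part c) (nth 0 (0 :: s) k) (nth 0 s k)].

Definition velocity c (t : R) : R[i] :=
  derive1 (re_part c) t +i* derive1 (im_part c) t.

(* The integrand is unspecified at the finitely many break points of [c],
   which form a null set. *)
Definition contour_integral c f : R[i] :=
  (\int[lebesgue_measure]_(t in `[0, 1]) complex.Re (f (c t) * velocity c t))
  +i*
  (\int[lebesgue_measure]_(t in `[0, 1]) complex.Im (f (c t) * velocity c t)).

Definition two_pi_i : R[i] := 0 +i* (2 * pi).

Definition winding_number c p : R[i] :=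
  two_pi_i^-1 * contour_integral c (fun z => (z - p)^-1).

Definition off_contour c p : Prop := forall t, t \in `[0, 1] -> c t != p.

(* [c] goes once around [p] in the positive direction. *)
Definition encloses c p : Prop := off_contour c p /\ winding_number c p = 1.

Definition leaves_outside c p : Prop :=
  off_contour c p /\ winding_number c p = 0.

(* For a meromorphic [f] this says exactly that [p] is a pole. *)
Definition is_pole f p : Prop :=
  complex.Re `|f z| @[z --> (p : R[i]^o)^'] --> +oo%R.

Definition schur_integrand (N : nat) (lam : 'I_N -> int) (lnx : R[i]) (q : R) :
    R[i] -> R[i] :=
  fun z => cpow lnx z * cpow (ln q)%:C z /
    \prod_(i < N) (cpow (ln q)%:C z - cpow (ln q)%:C (shifted_part lam i)%:~R).

End complex_analysis.

(* Main.v *)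
(* Since [w / prod_i (w - a_i)] splits into partial fractions in [w = q^z], the
   integral reduces to those of [x^z / (1 - e^{-b (z - l_i)})] with [b = ln q],
   and the resulting sum of residues is the expansion of the bialternant along
   its first row, all other minors being Vandermonde determinants.

   The residue of one such kernel is computed without Cauchy's theorem.  A
   uniform limit of polynomials on the contour has integral 0, and such limits
   form an algebra that contains exponentials and, by Neumann series, inverses of
   functions close to a nonzero constant.  The identity
   [1/(1 - E^2) = (1/(1 - E) + 1/(1 + E)) / 2] replaces [b] by [b/2] at the price
   of a second kernel centred at a pole around which the contour does not wind.
   Once [b] is small compared with the size of the contour, either the centre is
   so close that [b (z - z0) / (1 - e^{-b (z - z0)})] is a uniform limit of
   polynomials near the contour, or the kernel itself is one. *)
Require Import Defs.
From mathcomp Require Import all_boot all_order all_algebra.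
From mathcomp Require Import all_classical all_reals all_analysis.
From mathcomp Require Import complex.
From mathcomp Require Import measurable_realfun.
From mathcomp Require Import zify ring lra.

Set Implicit Arguments.
Unset Strict Implicit.
Unset Printing Implicit Defensive.

Import Order.TTheory GRing.Theory Num.Theory.
Import numFieldNormedType.Exports.

Local Open Scope ring_scope.
Local Open Scope complex_scope.

(** * Expansion of the bialternant *)

(** The hypotheses give only the winding numbers of [c] around poles of the integrand; nothing is
    known about its shape, and it may cross itself. Hence an integral along [c] is evaluated only by
    reduction to polynomials, which have antiderivatives, and to [(z - p)^-1] with [p] a pole. The
    halving respects this: [E ^+ 2 = 1] exactly when [E] is [1] or [-1], so the poles of both halved
    kernels are poles of the original one. Each halving doubles the gap between poles while the
    contour stays put, so that in the end at most one of them can be near it. The price is that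
    centres leave the real axis. Keeping [|b * y| <= pi] for their height [y] ensures that, when a
    centre is far away, the exponential of [i * b * y] is bounded away from [1]; the kernel is then
    a small perturbation of a nonzero constant. *)

Lemma prod_lt_pairs (F : comNzRingType) (n : nat) (h : 'I_n.+1)
    (f : 'I_n.+1 -> 'I_n.+1 -> F) :
  \prod_(i < n.+1) \prod_(j < n.+1 | (i < j)%N) f i j =
  (\prod_(j < n.+1 | (h < j)%N) f h j) * (\prod_(i < n.+1 | (i < h)%N) f i h) *
  \prod_(i < n) \prod_(j < n | (i < j)%N) f (lift h i) (lift h j).
Proof.
have ltb (i j : 'I_n) : (lift h i < lift h j)%N = (i < j)%N.
  by rewrite /= /bump; case: leqP; case: leqP; lia.
rewrite (bigD1_ord h) //= -mulrA; congr (_ * _).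
under eq_bigr => i _.
  rewrite (bigID (pred1 h)) /=.
  over.
rewrite big_split /=; congr (_ * _).
  rewrite [RHS]big_mkcond (bigD1_ord h) //= ltnn mul1r.
  apply: eq_bigr => i _; case: ifP => ih.
    rewrite (big_pred1 h) // => j /=; case: eqP => [->|]; last by rewrite andbF.
    by rewrite andbT.
  by rewrite big_pred0 // => j /=; case: eqP => [->|]; rewrite ?andbF ?andbT.
apply: eq_bigr => i _; rewrite big_mkcond (bigD1_ord h) //= eqxx andbF mul1r.
rewrite [RHS]big_mkcond /=; apply: eq_bigr => j _.
by rewrite eq_sym neq_lift andbT -ltb.
Qed.

(** Removing the node [y h] removes exactly the factors that involve it. The [n - h] factors with
    [h < j] have the opposite orientation, and [(-1) ^+ (n - h) = (-1) ^+ n * (-1) ^+ h]; the sign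
    [(-1) ^+ h] later cancels that of a cofactor. *)
Lemma det_Vandermonde_lift (F : comNzRingType) (n : nat) (h : 'I_n.+1)
    (y : 'I_n.+1 -> F) :
  \det (Vandermonde n.+1 (\row_j y j)) =
  (-1) ^+ n * (-1) ^+ h * \prod_(j < n.+1 | j != h) (y h - y j) *
  \det (Vandermonde n (\row_j y (lift h j))).
Proof.
have detE m (z : 'I_m -> F) : \det (Vandermonde m (\row_j z j)) =
    \prod_(i < m) \prod_(j < m | (i < j)%N) (z j - z i).
  rewrite det_Vandermonde; apply: eq_bigr => i _.
  by apply: eq_bigr => j _; rewrite !mxE.
rewrite !detE.
rewrite (prod_lt_pairs h (fun i j => y j - y i)); congr (_ * _).
rewrite [in RHS](bigID (fun j : 'I_n.+1 => (h < j)%N)) /=.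
have -> : \prod_(j < n.+1 | (h < j)%N) (y j - y h) =
    (-1) ^+ (n - h) * \prod_(j < n.+1 | (j != h) && (h < j)%N) (y h - y j).
  rewrite [in RHS](eq_bigl (fun j : 'I_n.+1 => (h < j)%N)); last first.
    by move=> j; rewrite -val_eqE /=; case: ltngtP.
  rewrite (eq_bigr (fun j => -1 * (y h - y j))); last by move=> j _; ring.
  rewrite big_split /= prodr_const; congr (_ ^+ _ * _).
  have card_gt m : (\sum_(j < m | (h < j)%N) 1 = m - h.+1)%N.
    elim: m => [|m IH]; first by rewrite big_ord0.
    by rewrite big_mkcond big_ord_recr -big_mkcond /= IH; case: ltnP; lia.
  by rewrite -sum1_card card_gt subSS.
have -> : \prod_(j < n.+1 | (j != h) && ~~ (h < j)%N) (y h - y j) =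
    \prod_(i < n.+1 | (i < h)%N) (y h - y i).
  by apply: eq_bigl => j; rewrite -val_eqE /=; case: ltngtP.
have hn : (h <= n)%N by rewrite -ltnS.
rewrite -exprD !mulrA; congr (_ * _ * _).
have -> : (n + h)%N = (n - h + h.*2)%N by lia.
by rewrite exprD -[X in _ = _ * X]signr_odd odd_double expr0 mulr1.
Qed.

(** Since [(q ^+ i) ^ m = (q ^ m) ^+ i], the numerator becomes a Vandermonde determinant in the
    nodes [q ^ m]. *)
Lemma schur_powersE (F : fieldType) (n : nat) (lam : 'I_n -> int) (q : F) :
  q != 0 ->
  schur lam (fun i => q ^+ i) =
  \det (Vandermonde n (\row_j q ^ shifted_part lam j)) /
  \prod_(i < n) \prod_(j < n | (i < j)%N) (q ^+ i - q ^+ j).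
Proof.
move=> q0; rewrite /schur; congr (\det _ / _); apply/matrixP => i j.
by rewrite !mxE !exprnP !exprz_exp mulrC.
Qed.

Lemma normalized_schur_sum (F : fieldType) (n : nat) (lam : 'I_n.+1 -> int)
    (x q : F) :
    q != 0 -> (forall m, (0 < m <= n)%N -> q ^+ m != 1) ->
    (forall i j, i != j -> q ^ shifted_part lam i != q ^ shifted_part lam j) ->
    (forall i, (i < n)%N -> x != q ^+ i) ->
  normalized_schur lam x q =
  qfact q n * q ^+ 'C(n, 2) * (q - 1) ^+ n
    / \prod_(1 <= i < n.+1) (x - q ^+ i.-1)
  * \sum_(i < n.+1) x ^ shifted_part lam i /
      \prod_(j < n.+1 | j != i)
        (q ^ shifted_part lam i - q ^ shifted_part lam j).
Proof.
move=> q0 qm yinj xq.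
set y := fun j => q ^ shifted_part lam j.
set u := fun i : 'I_n.+1 => if i == 0%N :> nat then x else q ^+ i.-1.
have qij (i j : nat) : (i < j <= n)%N -> q ^+ i - q ^+ j != 0.
  move=> ij; rewrite -(subnK (n := j) (m := i)); last by lia.
  rewrite exprD -{1}[q ^+ i]mul1r -mulrBl mulf_neq0 ?expf_neq0 //.
  by rewrite subr_eq0 eq_sym qm //; lia.
rewrite /normalized_schur -/u schur_powersE // /schur.
have D0 m (z : 'I_m -> F) : (forall i j, i != j -> z i != z j) ->
    \det (Vandermonde m (\row_j z j)) != 0.
  move=> zI; rewrite det_Vandermonde; apply/prodf_neq0 => i _.
  apply/prodf_neq0 => j ij; rewrite !mxE subr_eq0 zI //.
  by rewrite -val_eqE neq_ltn ij orbT.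
have -> : \det (\matrix_(i, j) (u i ^ shifted_part lam j)) =
    (-1) ^+ n * \det (Vandermonde n.+1 (\row_j y j)) *
    \sum_(i < n.+1) x ^ shifted_part lam i / \prod_(j < n.+1 | j != i) (y i - y j).
  rewrite (expand_det_row _ ord0) mulr_sumr; apply: eq_bigr => h _.
  rewrite mxE /u /= /cofactor.
  (* Row [i.+1] has argument [q ^+ i], so without row 0 the powers of each node start at exponent
     0. *)
  have -> : row' ord0 (col' h (\matrix_(i, j) (u i ^ shifted_part lam j))) =
      Vandermonde n (\row_j y (lift h j)).
    apply/matrixP => i j; rewrite !mxE /u lift0 /y /=.
    by rewrite !exprnP !exprz_exp mulrC.
  rewrite (det_Vandermonde_lift h) addnC exprD !expr0 mulr1.
  have P0 : \prod_(j < n.+1 | j != h) (y h - y j) != 0.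
    by apply/prodf_neq0 => j jh; rewrite subr_eq0 yinj // eq_sym.
  set P := \prod_(_ < _ | _) _ in P0 *.
  rewrite !mulrA -expr2 sqrr_sign mul1r.
  by field.
set W := \prod_(i < n) \prod_(j < n | (i < j)%N) (q ^+ i - q ^+ j).
have -> : \prod_(i < n.+1) \prod_(j < n.+1 | (i < j)%N) (u i - u j) =
    \prod_(1 <= i < n.+1) (x - q ^+ i.-1) * W.
  rewrite (prod_lt_pairs ord0 (fun i j => u i - u j)).
  rewrite [X in _ * X * _]big_pred0 // mulr1; congr (_ * _).
  rewrite big_mkcond big_ord_recl /= mul1r big_add1 big_mkord.
  by apply: eq_bigr => i _; rewrite /= /u lift0.
(* The pairs with larger index [n] give [q ^+ i - q ^+ n = - q ^+ i * (q ^+ (n - i) - 1)], hence the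
   sign, the power of [q] and the [q]-factorial. The other pairs form the same [W] as for the
   arguments [u]. *)
have -> : \prod_(i < n.+1) \prod_(j < n.+1 | (i < j)%N) (q ^+ i - q ^+ j) =
    (-1) ^+ n * (qfact q n * q ^+ 'C(n, 2) * (q - 1) ^+ n) * W.
  rewrite (prod_lt_pairs ord_max (fun i j : 'I_n.+1 => q ^+ i - q ^+ j)).
  rewrite [X in X * _ * _]big_pred0 ?mul1r; last first.
    by move=> j; rewrite ltnNge -ltnS ltn_ord.
  congr (_ * _); last first.
    by rewrite /W; apply: eq_bigr => i _; apply: eq_bigr => j _; rewrite !lift_max.
  rewrite big_mkcond big_ord_recr /= ltnn mulr1.
  under eq_bigr do rewrite ltn_ord.
  (* For [n = 0] the hypotheses do not exclude [q = 1]. *)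
  have [->|n0] := eqVneq n 0%N.
    by rewrite big_ord0 /qfact big_geq // !expr0 !mul1r.
  have q1 : q - 1 != 0.
    by rewrite subr_eq0 -[q]expr1 qm //; lia.
  rewrite [qfact q n * _ * _]mulrAC.
  have -> : qfact q n * (q - 1) ^+ n = \prod_(i < n) (q ^+ (n - i) - 1).
    rewrite /qfact big_add1 /= big_mkord -[X in _ ^+ X]card_ord -prodr_const.
    rewrite -big_split /= (reindex_inj rev_ord_inj); apply: eq_bigr => i _.
    by rewrite /qint /= subnSK // divfK.
  have -> : 'C(n, 2) = (\sum_(i < n) i)%N by rewrite -bin2_sum big_mkord.
  rewrite expr_sum -[X in (-1) ^+ X]card_ord -prodr_const.
  rewrite -!big_split /=; apply: eq_bigr => i _.
  have -> : q ^+ n = q ^+ (n - i) * q ^+ i by rewrite -exprD subnK // ltnW.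
  by ring.
rewrite -/y.
set V := \det _; set P := \prod_(_ <= _ < _) _; set Q := qfact _ _ * _ * _.
set S := \sum_(_ < _) _.
have V0 : V != 0 by exact: D0.
have W0 : W != 0.
  apply/prodf_neq0 => i _; apply/prodf_neq0 => j ij; rewrite qij // ij.
  by rewrite ltnW.
have P0 : P != 0.
  rewrite /P big_add1 big_mkord; apply/prodf_neq0 => i _ /=.
  by rewrite subr_eq0 xq.
rewrite invf_div; move: ((-1) ^+ n) (sqrr_sign F n) => s s2.
have -> : s * V * S / (P * W) * (s * Q * W / V) = s ^+ 2 * Q / P * S.
  by field; rewrite P0 W0 V0.
by rewrite s2 mul1r.
Qed.

(** * Complex norm and exponential *)

Section complex_norm.
Variable R : realType.
Implicit Types (z w : R[i]) (r : R).

(* The norm [`|z|] of a complex number lives in [R[i]]; this is its real value. *)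
Definition cnorm z : R := complex.Re `|z|.

Lemma cnormE z : (cnorm z)%:C = `|z|.
Proof. by rewrite /cnorm RRe_real ?normr_real. Qed.

Lemma cnorm_ge0 z : 0 <= cnorm z.
Proof. by rewrite -lecR cnormE normr_ge0. Qed.

Lemma cnorm0 : cnorm 0 = 0.
Proof. by rewrite /cnorm normr0. Qed.

Lemma cnorm_eq0 z : (cnorm z == 0) = (z == 0).
Proof. by rewrite -(inj_eq (@complexI R)) cnormE normr_eq0. Qed.

Lemma cnorm_gt0 z : (0 < cnorm z) = (z != 0).
Proof. by rewrite lt0r cnorm_eq0 cnorm_ge0 andbT. Qed.

Lemma cnormM z w : cnorm (z * w) = cnorm z * cnorm w.
Proof. by apply: complexI; rewrite rmorphM /= !cnormE normrM. Qed.

Lemma cnormV z : cnorm z^-1 = (cnorm z)^-1.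
Proof. by apply: complexI; rewrite fmorphV /= !cnormE normfV. Qed.

Lemma cnormX z n : cnorm (z ^+ n) = cnorm z ^+ n.
Proof. by apply: complexI; rewrite rmorphXn /= !cnormE normrX. Qed.

Lemma cnormN z : cnorm (- z) = cnorm z.
Proof. by rewrite /cnorm normrN. Qed.

Lemma cnormBC z w : cnorm (z - w) = cnorm (w - z).
Proof. by rewrite /cnorm distrC. Qed.

Lemma cnormD z w : cnorm (z + w) <= cnorm z + cnorm w.
Proof. by rewrite -lecR rmorphD /= !cnormE ler_normD. Qed.

Lemma cnormB z w : cnorm (z - w) <= cnorm z + cnorm w.
Proof. by rewrite -(cnormN w) cnormD. Qed.

Lemma cnorm_real r : cnorm r%:C = `|r|.
Proof. by rewrite /cnorm normc_def /= expr0n addr0 sqrtr_sqr. Qed.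

Lemma cnorm1 : cnorm 1 = 1.
Proof. by rewrite (cnorm_real 1) normr1. Qed.

Lemma cnorm_sum (I : Type) (s : seq I) (P : pred I) (F : I -> R[i]) :
  cnorm (\sum_(i <- s | P i) F i) <= \sum_(i <- s | P i) cnorm (F i).
Proof.
elim/big_rec2: _ => [|i y x _ le]; first by rewrite cnorm0.
exact: le_trans (cnormD _ _) (lerD _ _).
Qed.

Lemma sqr_cnorm z : cnorm z ^+ 2 = complex.Re z ^+ 2 + complex.Im z ^+ 2.
Proof. by rewrite /cnorm normc_def /= sqr_sqrtr // addr_ge0 ?sqr_ge0. Qed.

Lemma Re_le_cnorm z : `|complex.Re z| <= cnorm z.
Proof.
rewrite -(ler_pXn2r (n := 2)) ?nnegrE ?cnorm_ge0 // sqr_cnorm.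
by rewrite real_normK ?num_real // lerDl sqr_ge0.
Qed.

Lemma Im_le_cnorm z : `|complex.Im z| <= cnorm z.
Proof.
rewrite -(ler_pXn2r (n := 2)) ?nnegrE ?cnorm_ge0 // sqr_cnorm.
by rewrite real_normK ?num_real // lerDr sqr_ge0.
Qed.

Lemma cnorm_le_ReIm z : cnorm z <= `|complex.Re z| + `|complex.Im z|.
Proof.
rewrite -(ler_pXn2r (n := 2)) ?nnegrE ?addr_ge0 ?cnorm_ge0 // sqr_cnorm.
rewrite sqrrD !real_normK ?num_real // addrAC lerDl.
by rewrite mulrn_wge0 ?mulr_ge0.
Qed.

End complex_norm.

(** * Explicit bounds for the exponential *)

Section complex_exponential.
Variable R : realType.
Implicit Types (z w v : R[i]) (r x y : R).

Lemma cexpD z w : cexp (z + w) = cexp z * cexp w.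
Proof.
case: z w => [a b] [c d]; rewrite /cexp /= expRD cosD sinD.
by apply/eqP; rewrite eq_complex /=; apply/andP; split; apply/eqP; ring.
Qed.

Lemma cexp_real r : cexp r%:C = (expR r)%:C.
Proof. by rewrite /cexp /= cos0 sin0 mulr1 mulr0. Qed.

Lemma cexp0 : cexp 0 = 1 :> R[i].
Proof. by rewrite (cexp_real 0) expR0. Qed.

Lemma cexpN z : cexp (- z) = (cexp z)^-1.
Proof.
have /eqP := cexpD z (- z); rewrite subrr cexp0 => /eqP e.
have z0 : cexp z != 0.
  by apply: contra_eq_neq e => ->; rewrite mul0r oner_neq0.
by rewrite -[LHS](mulKf z0) -e mulr1.
Qed.

Lemma cnorm_cexp z : cnorm (cexp z) = expR (complex.Re z).
Proof.
rewrite /cnorm normc_def /= !exprMn -mulrDr cos2Dsin2 mulr1.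
by rewrite sqrtr_sqr gtr0_norm ?expR_gt0.
Qed.

Lemma cexp_neq0 z : cexp z != 0.
Proof. by rewrite -cnorm_gt0 cnorm_cexp expR_gt0. Qed.

Lemma cexpMn z n : cexp (z *+ n) = cexp z ^+ n.
Proof.
elim: n => [|n IH]; first by rewrite mulr0n cexp0.
by rewrite mulrS cexpD IH exprS.
Qed.

Lemma cexpMz z (m : int) : cexp (z *~ m) = cexp z ^ m.
Proof.
case: m => n; first exact: cexpMn.
by rewrite NegzE mulrNz cexpN -invr_expz; congr (_^-1); exact: cexpMn.
Qed.

Lemma abs_sin_le x : `|sin x| <= `|x|.
Proof.
wlog x0 : x / 0 <= x.
  move=> H; have [/H //|/ltW x0] := leP 0 x.
  by rewrite -normrN -sinN -[leRHS]normrN H ?oppr_ge0.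
have [->|xn0] := eqVneq x 0; first by rewrite sin0.
have x_gt0 : 0 < x by rewrite lt0r xn0.
have [c _] := MVT x_gt0 (fun y _ => is_derive_sin y)
  (continuous_subspaceT (@continuous_sin R)).
rewrite sin0 !subr0 => ->.
by rewrite normrM ler_piMl // cos_max.
Qed.

Lemma onemcos_ge0_le x : 0 <= 1 - cos x <= x ^+ 2 / 2.
Proof.
rewrite subr_ge0 cos_le1 /=.
have -> : 1 - cos x = sin (x / 2) ^+ 2 *+ 2.
  have -> : cos x = cos (x / 2 *+ 2) by rewrite mulr2n -splitr.
  by rewrite cos_mulr2n sin2cos2; ring.
have : sin (x / 2) ^+ 2 <= (x / 2) ^+ 2.
  by rewrite -real_normK ?num_real // -[leRHS]real_normK ?num_real //
    lerXn2r ?nnegrE ?abs_sin_le.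
by rewrite -mulr_natr; lra.
Qed.

Lemma abs_sinB_le x : `|sin x - x| <= `|x| * (x ^+ 2 / 2).
Proof.
wlog x0 : x / 0 <= x.
  move=> H; have [/H //|/ltW x0] := leP 0 x.
  have := H (- x); rewrite oppr_ge0 sinN normrN sqrrN opprK [- _ + _]addrC distrC.
  exact.
have [->|xn0] := eqVneq x 0; first by rewrite sin0 subrr normr0 mul0r.
have x_gt0 : 0 < x by rewrite lt0r xn0.
have [c] := MVT x_gt0 (fun y _ => is_derive_sin y)
  (continuous_subspaceT (@continuous_sin R)).
rewrite in_itv /= => /andP[c0 cx]; rewrite sin0 !subr0 => ->.
rewrite -{2}[x]mul1r -mulrBl normrM mulrC ler_wpM2l //.
have /andP[h0 h1] := onemcos_ge0_le c.
rewrite -normrN opprB ger0_norm //; apply: le_trans h1 _.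
by rewrite ler_wpM2r // lerXn2r ?nnegrE ?ltW.
Qed.

(** The inequality [1 - x <= expR (- x)] gives [expR x * (1 - x) <= 1], while [(1 - x) * (1 + x + 2
    * x ^+ 2) = 1 + x ^+ 2 * (1 - 2 * x)] is at least [1] for [x <= 1 / 2]. *)
Lemma expR_quadratic x : `|x| <= 1 / 2 -> `|expR x - 1 - x| <= 2 * x ^+ 2.
Proof.
rewrite ler_norml => /andP[x1 x2].
have h1 := expR_ge1Dx x; have h2 := expR_ge1Dx (- x).
have h3 : expR x * expR (- x) = 1 by rewrite expRxMexpNx_1.
have h4 := expR_gt0 x.
rewrite ger0_norm; last lra.
have h5 : expR x * (1 - x) <= 1 by rewrite -[leRHS]h3 ler_pM2l.
have : (expR x - 1 - x - 2 * x ^+ 2) * (1 - x) <= 0 by nra.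
by rewrite pmulr_lle0 ?subr_le0 //; lra.
Qed.

(** For [v = x + iy] the real part of the error is at most [2 * x ^+ 2 + y ^+ 2] and the imaginary
    part at most [x ^+ 2 + 2 * y ^+ 2]; the sum is below [4 * cnorm v ^+ 2]. *)
Lemma cexp_quadratic v :
  cnorm v <= 1 / 2 -> cnorm (cexp v - 1 - v) <= 4 * cnorm v ^+ 2.
Proof.
move=> v2; have x2 := le_trans (Re_le_cnorm v) v2.
have y2 := le_trans (Im_le_cnorm v) v2.
apply: le_trans (cnorm_le_ReIm _) _; rewrite sqr_cnorm.
case: v x2 y2 {v2} => x y /= x2 y2; rewrite subr0.
have ex := expR_quadratic x2.
have /andP[c0 c1] := onemcos_ge0_le y.
have s1 := abs_sinB_le y.
have e0 := expR_gt0 x.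
have x2' := x2; have y2' := y2.
move: x2'; rewrite ler_norml => /andP[xa xb].
have sx : x ^+ 2 <= 1 / 4 by nra.
have e2 : expR x <= 2 by move: ex; rewrite ler_norml => /andP[_]; lra.
have hre : `|expR x * cos y - 1 - x| <= 2 * x ^+ 2 + y ^+ 2.
  have -> : expR x * cos y - 1 - x =
    (expR x - 1 - x) - expR x * (1 - cos y) by ring.
  apply: le_trans (ler_normB _ _) (lerD ex _).
  by rewrite normrM gtr0_norm // ger0_norm //; nra.
have him : `|expR x * sin y - y| <= x ^+ 2 + 2 * y ^+ 2.
  have -> : expR x * sin y - y = (expR x - 1) * sin y + (sin y - y) by ring.
  apply: le_trans (ler_normD _ _) _; rewrite normrM.
  have hx : `|expR x - 1| <= 2 * `|x|.
    have -> : expR x - 1 = (expR x - 1 - x) + x by ring.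
    apply: le_trans (ler_normD _ _) _.
    by rewrite -(real_normK (num_real x)) in ex *; have := normr_ge0 x; nra.
  have hy := abs_sin_le y.
  have hxy : `|expR x - 1| * `|sin y| <= 2 * `|x| * `|y| by rewrite ler_pM.
  have := normr_ge0 x; have := normr_ge0 y.
  move: hxy s1; rewrite -(real_normK (num_real x)) -(real_normK (num_real y)).
  move: x2 y2; set X := `|x|; set Y := `|y| => x2 y2 hxy s1 Y0 X0.
  have : Y * (Y ^+ 2 / 2) <= Y ^+ 2 by nra.
  have : 0 <= (X - Y) ^+ 2 by exact: sqr_ge0.
  by nra.
by have := sqr_ge0 x; have := sqr_ge0 y; lra.
Qed.

(** Below [1 / 8] the quadratic error [4 * cnorm v ^+ 2] is at most half of [cnorm v]. The lower
    bound serves to isolate the zeros of [cexp v - 1]. *)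
Lemma cexp_near1 v : cnorm v <= 1 / 8 ->
  cnorm (cexp v - 1) <= 2 * cnorm v /\ cnorm v / 2 <= cnorm (cexp v - 1).
Proof.
move=> v8; have n0 := cnorm_ge0 v.
have q : cnorm (cexp v - 1 - v) <= 4 * cnorm v ^+ 2 by apply: cexp_quadratic; lra.
have := cnormD (cexp v - 1 - v) v; rewrite subrK.
have := cnormB (cexp v - 1) (cexp v - 1 - v); rewrite opprB addrC subrK.
by split; nra.
Qed.

(** Writing [cexp z] as the [n]-th power of [cexp (z / n)], the difference of [n]-th powers factors:
    the bases differ by at most [4 * (r / n) ^+ 2], and the cofactor is a sum of [n] terms bounded
    by [expR r]. *)
Lemma expn_1Ddiv_cexp z r (n : nat) :
  cnorm z <= r -> (0 < n)%N -> 2 * r <= n%:R ->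
  cnorm ((1 + z / n%:R) ^+ n - cexp z) <= 4 * r ^+ 2 * expR r / n%:R.
Proof.
move=> zr n0 rn; have nR : 0 < n%:R :> R by rewrite ltr0n.
have nC : n%:R != 0 :> R[i] by rewrite pnatr_eq0 -lt0n.
have r0 : 0 <= r by exact: le_trans (cnorm_ge0 z) zr.
set v := z / n%:R.
have vE : cnorm v = cnorm z / n%:R.
  by rewrite cnormM cnormV -[n%:R]/((n%:R : R[i])) -(rmorph_nat (real_complex R)) cnorm_real gtr0_norm.
have vr : cnorm v <= r / n%:R by rewrite vE ler_pM2r ?invr_gt0.
have -> : cexp z = cexp v ^+ n by rewrite -cexpMn -mulr_natr divfK.
have v2 : cnorm v <= 1 / 2.
  by apply: le_trans vr _; rewrite ler_pdivrMr //; lra.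
have M1 : cnorm (1 + v) <= expR (r / n%:R).
  apply: le_trans (cnormD _ _) _; rewrite cnorm1.
  by apply: le_trans (expR_ge1Dx _); rewrite lerD2l.
have M2 : cnorm (cexp v) <= expR (r / n%:R).
  rewrite cnorm_cexp ler_expR; apply: le_trans vr.
  exact: le_trans (ler_norm _) (Re_le_cnorm _).
rewrite subrXX cnormM.
have q : cnorm (1 + v - cexp v) <= 4 * (r / n%:R) ^+ 2.
  rewrite cnormBC opprD addrA; apply: le_trans (cexp_quadratic v2) _.
  by rewrite ler_wpM2l // lerXn2r ?nnegrE ?cnorm_ge0 ?divr_ge0 // ltW.
have s : cnorm (\sum_(i < n) (1 + v) ^+ (n.-1 - i) * cexp v ^+ i) <=
    n%:R * expR r.
  apply: le_trans (cnorm_sum _ _ _) _.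
  have -> : n%:R * expR r = \sum_(i < n) expR r.
    by rewrite sumr_const card_ord mulr_natl.
  apply: ler_sum => i _; rewrite cnormM !cnormX.
  apply: (@le_trans _ _ (expR (r / n%:R) ^+ n.-1)).
    have -> : expR (r / n%:R) ^+ n.-1 =
        expR (r / n%:R) ^+ (n.-1 - i) * expR (r / n%:R) ^+ i.
      by rewrite -exprD subnK // -ltnS prednK.
    by rewrite ler_pM ?exprn_ge0 ?cnorm_ge0 // lerXn2r ?nnegrE ?cnorm_ge0 ?expR_ge0.
  have -> : expR r = expR (r / n%:R) ^+ n.
    by rewrite -expRM_natl mulrC divfK ?gt_eqF.
  by rewrite -[X in _ <= _ ^+ X](prednK n0) exprS ler_peMl ?exprn_ge0 ?expR_ge0 //
    -expR0 ler_expR divr_ge0 // ltW.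
apply: le_trans (ler_pM _ _ q s) _; rewrite ?cnorm_ge0 //.
rewrite le_eqVlt; apply/orP; left; apply/eqP.
by field; rewrite gt_eqF.
Qed.

End complex_exponential.

(** * Uniform limits of polynomials *)

Section polynomial_approximation.
Local Open Scope classical_set_scope.
Local Open Scope ring_scope.
Local Open Scope complex_scope.
Variable R : realType.
Implicit Types (S : set R[i]) (f g h : R[i] -> R[i]) (z w p : R[i]) (r e : R).

Definition poly_approx S h := forall e, 0 < e ->
  exists P : {poly R[i]}, forall z, S z -> cnorm (h z - P.[z]) <= e.

Lemma poly_approx_horner S (P : {poly R[i]}) : poly_approx S (horner P).
Proof.
by move=> e e0; exists P => z _; rewrite subrr cnorm0 ltW.
Qed.

Lemma eq_poly_approx S h g :
  (forall z, S z -> h z = g z) -> poly_approx S h -> poly_approx S g.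
Proof.
by move=> hg ah e /ah [P hP]; exists P => z Sz; rewrite -hg // hP.
Qed.

Lemma poly_approx_cst S w : poly_approx S (fun=> w).
Proof.
apply: eq_poly_approx (poly_approx_horner S w%:P) => z _; exact: hornerC.
Qed.

Lemma poly_approxD S h g :
  poly_approx S h -> poly_approx S g -> poly_approx S (fun z => h z + g z).
Proof.
move=> ah ag e e0; have e2 : 0 < e / 2 by rewrite divr_gt0.
have [P hP] := ah _ e2; have [Q hQ] := ag _ e2; exists (P + Q) => z Sz.
rewrite hornerD opprD addrACA [leRHS]splitr.
by apply: le_trans (cnormD _ _) (lerD (hP _ Sz) (hQ _ Sz)).
Qed.

Lemma poly_approx_lim S h :
  (forall e, 0 < e -> exists2 g, poly_approx S g &
     forall z, S z -> cnorm (h z - g z) <= e) -> poly_approx S h.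
Proof.
move=> H e e0; have e2 : 0 < e / 2 by rewrite divr_gt0.
have [g ag hg] := H _ e2; have [P hP] := ag _ e2; exists P => z Sz.
rewrite [leRHS]splitr -(subrKA (g z)).
by apply: le_trans (cnormD _ _) (lerD (hg _ Sz) (hP _ Sz)).
Qed.

(** * Closure properties of uniform limits of polynomials on a bounded set *)

Section bounded.
Variables (S : set R[i]) (r : R).
Hypothesis S_le : forall z, S z -> cnorm z <= r.

Lemma horner_bounded (P : {poly R[i]}) :
  exists2 M, 0 < M & forall z, S z -> cnorm P.[z] <= M.
Proof.
elim/poly_ind: P => [|P a [M M0 hM]].
  by exists 1 => // z _; rewrite horner0 cnorm0.
exists (M * `|r| + cnorm a + 1) => [|z Sz].
  by rewrite ltr_wpDl // addr_ge0 ?cnorm_ge0 // mulr_ge0 // ltW.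
rewrite hornerMXaddC -[leLHS]addr0 lerD //.
apply: le_trans (cnormD _ _) _; rewrite lerD2r cnormM.
rewrite ler_pM ?cnorm_ge0 ?hM //.
exact: le_trans (S_le Sz) (ler_norm _).
Qed.

Lemma poly_approx_bounded h : poly_approx S h ->
  exists2 M, 0 < M & forall z, S z -> cnorm (h z) <= M.
Proof.
move=> /(_ 1 ltr01) [P hP]; have [M M0 hM] := horner_bounded P.
exists (1 + M) => [|z Sz]; first by rewrite addr_gt0.
rewrite -[h z](subrK P.[z]).
exact: le_trans (cnormD _ _) (lerD (hP _ Sz) (hM _ Sz)).
Qed.

Lemma poly_approxM h g :
  poly_approx S h -> poly_approx S g -> poly_approx S (fun z => h z * g z).
Proof.
move=> ah ag e e0; have [M M0 hM] := poly_approx_bounded ah.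
have [L L0 hL] := poly_approx_bounded ag.
(* The minimum with [1] makes the approximation of [h] bounded by [M + 1]. *)
have d0 : 0 < Num.min 1 (e / 2 / L) by rewrite lt_min ltr01 !divr_gt0.
have d1 : 0 < e / 2 / (M + 1) by rewrite !divr_gt0 // addr_gt0.
have [P hP] := ah _ d0; have [Q hQ] := ag _ d1; exists (P * Q) => z Sz.
rewrite hornerM.
have -> : h z * g z - P.[z] * Q.[z] =
  (h z - P.[z]) * g z + P.[z] * (g z - Q.[z]) by ring.
rewrite [leRHS]splitr; apply: le_trans (cnormD _ _) (lerD _ _); rewrite cnormM.
  apply: (@le_trans _ _ (e / 2 / L * L)); last by rewrite divfK ?gt_eqF.
  rewrite ler_pM ?cnorm_ge0 ?hL //; apply: le_trans (hP _ Sz) _.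
  by rewrite ge_min lexx orbT.
apply: (@le_trans _ _ ((M + 1) * (e / 2 / (M + 1)))).
  rewrite ler_pM ?cnorm_ge0 ?hQ // -(subrK (h z) P.[z]) addrC.
  apply: le_trans (cnormD _ _) (lerD (hM _ Sz) _); rewrite cnormBC.
  by apply: le_trans (hP _ Sz) _; rewrite ge_min lexx.
by rewrite mulrC divfK ?gt_eqF // addr_gt0.
Qed.

Lemma poly_approxX h n : poly_approx S h -> poly_approx S (fun z => h z ^+ n).
Proof.
move=> ah; elim: n => [|n IH]; first exact: poly_approx_cst.
by apply: eq_poly_approx (poly_approxM ah IH) => z _; rewrite exprS.
Qed.

Lemma poly_approx_sum n (h : nat -> R[i] -> R[i]) :
  (forall i, poly_approx S (h i)) -> poly_approx S (fun z => \sum_(i < n) h i z).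
Proof.
move=> ah; elim: n => [|n IH].
  by apply: eq_poly_approx (poly_approx_cst S 0) => z _; rewrite big_ord0.
apply: eq_poly_approx (poly_approxD IH (ah n)) => z _.
by rewrite big_ord_recr.
Qed.

Lemma poly_approx_affine w v : poly_approx S (fun z => w * z + v).
Proof.
apply: eq_poly_approx (poly_approx_horner S (w%:P * 'X + v%:P)) => z _.
by rewrite !hornerE.
Qed.

Lemma expn_1Ddiv_cexp_lt rho e : 0 <= rho -> 0 < e ->
  exists2 n, (0 < n)%N & forall z, cnorm z <= rho ->
    cnorm ((1 + z / n%:R) ^+ n - cexp z) <= e.
Proof.
move=> rho0 e0; have E0 := expR_ge0 rho.
(* An integer above the first summand may be used in [expn_1Ddiv_cexp]; one above the second brings
   the error below [e]. *)
pose x := 2 * rho + 4 * rho ^+ 2 * expR rho / e.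
have h1 : 0 <= 2 * rho by rewrite mulr_ge0.
have h2 : 0 <= 4 * rho ^+ 2 * expR rho / e.
  by rewrite divr_ge0 ?mulr_ge0 ?exprn_ge0 // ltW.
have xn : x < (Num.bound x)%:R by rewrite archi_boundP // addr_ge0.
have n0 : 0 < (Num.bound x)%:R :> R by apply: le_lt_trans xn; rewrite addr_ge0.
exists (Num.bound x) => [|z zr]; first by rewrite -(ltr0n R).
apply: le_trans (expn_1Ddiv_cexp zr _ _) _.
- by rewrite -(ltr0n R).
- by apply: le_trans (ltW xn); rewrite lerDl.
rewrite ler_pdivrMr // [e * _]mulrC -ler_pdivrMr //.
by apply: le_trans (ltW xn); rewrite lerDr.
Qed.

Lemma poly_approx_cexp w v : poly_approx S (fun z => cexp (w * z + v)).
Proof.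
apply: poly_approx_lim => e e0.
have rho0 : 0 <= cnorm w * `|r| + cnorm v by rewrite addr_ge0 ?mulr_ge0 ?cnorm_ge0.
have [n n0 hn] := expn_1Ddiv_cexp_lt rho0 e0.
exists (fun z => (1 + (w * z + v) / n%:R) ^+ n) => [|z Sz].
  apply: poly_approxX; apply: poly_approxD; first exact: poly_approx_cst.
  by apply: poly_approxM; [exact: poly_approx_affine|exact: poly_approx_cst].
rewrite cnormBC hn //; apply: le_trans (cnormD _ _) _; rewrite lerD2r cnormM.
rewrite ler_pM ?cnorm_ge0 //; exact: le_trans (S_le Sz) (ler_norm _).
Qed.

Lemma exprn_lt_eventually (rho e : R) :
  0 <= rho -> rho < 1 -> 0 < e -> exists n, rho ^+ n <= e.
Proof.
move=> rho0 rho1 e0.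
have /cvg_expr : `|rho| < 1 by rewrite ger0_norm.
move=> /cvgr0Pnorm_le /(_ _ e0) [n _ /(_ n (leqnn n))] /=.
by exists n; rewrite -[leLHS]ger0_norm // exprn_ge0.
Qed.

(* Neumann series around [w]. *)
Lemma poly_approxV h w (rho : R) : w != 0 -> rho < 1 ->
  (forall z, S z -> cnorm (h z - w) <= rho * cnorm w) ->
  poly_approx S h -> poly_approx S (fun z => (h z)^-1).
Proof.
move=> w0 rho1 hw ah; have W0 : 0 < cnorm w by rewrite cnorm_gt0.
apply: poly_approx_lim => e e0.
(* The maximum covers a negative [rho], which is possible when [S] is empty. *)
have r0 : 0 < 1 - Num.max rho 0 by rewrite subr_gt0 gt_max rho1 ltr01.
have d0 : 0 < e * (1 - Num.max rho 0) * cnorm w by rewrite !mulr_gt0.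
have rho0 : 0 <= Num.max rho 0 by rewrite le_max lexx orbT.
have rho1' : Num.max rho 0 < 1 by rewrite -subr_gt0.
have [n hn] := exprn_lt_eventually rho0 rho1' d0.
pose k z := 1 - h z / w.
exists (fun z => (\sum_(i < n) k z ^+ i) / w) => [|z Sz].
  apply: poly_approxM; last exact: poly_approx_cst.
  apply: (@poly_approx_sum n (fun i z => k z ^+ i)) => i; apply: poly_approxX.
  apply: poly_approxD; first exact: poly_approx_cst.
  apply: eq_poly_approx (poly_approxM ah (poly_approx_cst S (- w^-1))) => z _.
  by rewrite mulrN.
have k_le : cnorm (k z) <= Num.max rho 0.
  have -> : k z = - ((h z - w) / w) by rewrite /k; field.
  rewrite cnormN cnormM cnormV ler_pdivrMr //; apply: le_trans (hw _ Sz) _.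
  by rewrite ler_wpM2r ?cnorm_ge0 // le_max lexx.
have hE : h z = (1 - k z) * w by rewrite /k; field.
have k1 : 1 - Num.max rho 0 <= cnorm (1 - k z).
  have := cnormD (1 - k z) (k z); rewrite subrK cnorm1 => H1.
  by rewrite lerBlDr; apply: le_trans H1 _; rewrite lerD2l.
have k10 : 1 - k z != 0 by rewrite -cnorm_gt0 (lt_le_trans r0).
have -> : (h z)^-1 - (\sum_(i < n) k z ^+ i) / w = k z ^+ n / ((1 - k z) * w).
  rewrite hE; have := subrX1 (k z) n; set s := \sum_(i < n) _ => Hs.
  have -> : k z ^+ n = 1 - (1 - k z) * s.
    by apply/eqP; rewrite eq_sym subr_eq addrC -subr_eq; apply/eqP;
      rewrite -opprB Hs -mulNr opprB.
  by field; rewrite w0 k10.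
rewrite cnormM cnormX cnormV ler_pdivrMr cnormM; last by rewrite mulr_gt0 // (lt_le_trans r0).
apply: (@le_trans _ _ (Num.max rho 0 ^+ n)).
  by rewrite lerXn2r ?nnegrE ?cnorm_ge0 // le_max lexx orbT.
apply: le_trans hn _; rewrite mulrA ler_wpM2r ?cnorm_ge0 //.
by rewrite ler_wpM2l // ltW.
Qed.

End bounded.

(* The value at 0 removes the singularity. *)
Definition expquot z := if z == 0 then 1 else (1 - cexp (- z)) / z.

Lemma expquotM z : z * expquot z = 1 - cexp (- z).
Proof.
rewrite /expquot; have [->|z0] := eqVneq z 0.
  by rewrite mul0r oppr0 cexp0 subrr.
by rewrite mulrC divfK.
Qed.

Lemma expquot_near1 z : cnorm z <= 1 / 2 -> cnorm (expquot z - 1) <= 4 * cnorm z.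
Proof.
rewrite /expquot; have [->|z0 z2] := eqVneq z 0.
  by rewrite subrr cnorm0 mulr0.
have -> : (1 - cexp (- z)) / z - 1 = - (cexp (- z) - 1 - - z) / z by field.
rewrite cnormM cnormN cnormV ler_pdivrMr ?cnorm_gt0 //.
apply: le_trans (cexp_quadratic _) _; first by rewrite cnormN.
by rewrite cnormN mulrA.
Qed.

(** With [u = w * (z - p)], the quotient [(1 - (1 - u / n) ^+ n) / u] is the geometric sum of the
    powers of [1 - u / n], divided by [n], hence a polynomial. Away from [p] the division by [u]
    inflates the error by at most [(cnorm w * delta)^-1]; at [p] both sides equal [1]. *)
Lemma poly_approx_expquot S r (delta : R) p w : 0 < delta -> w != 0 ->
  (forall z, S z -> cnorm z <= r) ->
  (forall z, S z -> z != p -> delta <= cnorm (z - p)) ->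
  poly_approx S (fun z => expquot (w * (z - p))).
Proof.
move=> d0 w0 Sr Sp; apply: poly_approx_lim => e e0.
have rho0 : 0 <= cnorm w * (`|r| + cnorm p).
  by rewrite mulr_ge0 ?addr_ge0 ?cnorm_ge0.
have W0 : 0 < cnorm w by rewrite cnorm_gt0.
have e1 : 0 < e * (cnorm w * delta) by rewrite !mulr_gt0.
have [n n0 hn] := expn_1Ddiv_cexp_lt rho0 e1.
have nC : n%:R != 0 :> R[i] by rewrite pnatr_eq0 -lt0n.
pose k z := 1 - w * (z - p) / n%:R.
exists (fun z => n%:R^-1 * \sum_(i < n) k z ^+ i) => [|z Sz].
  apply: (poly_approxM Sr); first exact: poly_approx_cst.
  apply: (@poly_approx_sum S n (fun i z => k z ^+ i)) => i.
  apply: (poly_approxX Sr).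
  apply: eq_poly_approx (poly_approx_affine S (- w / n%:R) (1 + w * p / n%:R)) => z _.
  by rewrite /k; field.
have [->|zp] := eqVneq z p.
  rewrite /k subrr mulr0 mul0r subr0 /expquot eqxx.
  rewrite (eq_bigr (fun=> 1)) => [|i _]; last by rewrite expr1n.
  by rewrite sumr_const card_ord mulVf // subrr cnorm0 ltW.
have zp0 : z - p != 0 by rewrite subr_eq0.
have u0 : w * (z - p) != 0 by rewrite mulf_neq0.
rewrite /expquot (negPf u0).
have := subrX1 (k z) n; set s := \sum_(i < n) _ => Hs.
have -> : (1 - cexp (- (w * (z - p)))) / (w * (z - p)) - n%:R^-1 * s =
    ((1 + - (w * (z - p)) / n%:R) ^+ n - cexp (- (w * (z - p)))) / (w * (z - p)).
  have -> : n%:R^-1 * s = (1 - k z ^+ n) / (w * (z - p)).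
    by rewrite -[1 - _]opprB Hs /k; field; rewrite nC w0 zp0.
  rewrite /k mulNr -mulrBl; congr (_ / _).
  by rewrite opprB addrC addrA subrK.
rewrite cnormM cnormV ler_pdivrMr ?cnorm_gt0 //.
apply: le_trans (hn _ _) _.
  rewrite cnormN cnormM ler_wpM2l ?cnorm_ge0 //.
  apply: le_trans (cnormB _ _) _; rewrite lerD2r.
  exact: le_trans (Sr _ Sz) (ler_norm _).
by rewrite cnormM ler_wpM2l ?(ltW e0) // ler_wpM2l ?(ltW W0) // Sp.
Qed.

(** If [P] approximates [h], then [z - p] divides [P - P.[p]] and the quotient approximates the
    divided difference, with error at most twice that of [P], over [delta]. *)
Lemma poly_approx_divided_difference S S' (delta : R) p h : 0 < delta ->
  (forall z, S' z -> S z /\ delta <= cnorm (z - p)) -> S p ->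
  poly_approx S h -> poly_approx S' (fun z => (h z - h p) / (z - p)).
Proof.
move=> d0 S'S Sp ah e e0.
have e1 : 0 < e * delta / 2 by rewrite divr_gt0 // mulr_gt0.
have [P hP] := ah _ e1.
have /factor_theorem [Q PQ] : root (P - P.[p]%:P) p.
  by rewrite rootE !hornerE subrr.
exists Q => z /S'S [Sz zp].
have zp0 : z - p != 0 by rewrite -cnorm_gt0 (lt_le_trans d0).
have /(congr1 (horner^~ z)) := PQ; rewrite !hornerE => Qz.
have -> : (h z - h p) / (z - p) - Q.[z] =
    ((h z - P.[z]) - (h p - P.[p])) / (z - p).
  have -> : Q.[z] = (P.[z] - P.[p]) / (z - p) by rewrite Qz mulfK.
  by field.
rewrite cnormM cnormV ler_pdivrMr ?cnorm_gt0 //.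
apply: le_trans (cnormB _ _) _.
apply: le_trans (lerD (hP _ Sz) (hP _ Sp)) _.
by rewrite -splitr ler_wpM2l // ltW.
Qed.

End polynomial_approximation.

(** * Integration along contours *)

Section C1_arcs.
Local Open Scope classical_set_scope.
Local Open Scope ring_scope.
Local Open Scope complex_scope.
Variable R : realType.
Implicit Types (a b : R) (g h : R -> R) (F G : R -> R[i]).
Local Notation mu := (@lebesgue_measure R).

(** At the ends of a segment the derivative of a curve has no prescribed value, so [g] is compared
    with a continuous [h] inside only; the two end points form a null set. *)
Lemma integrable_itv_cc_oo g h a b : a < b ->
  {within `[a, b], continuous h} -> {in `]a, b[, g =1 h} ->
  mu.-integrable `[a, b] (EFin \o g) /\
  (\int[mu]_(t in `[a, b]) g t = \int[mu]_(t in `[a, b]) h t).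
Proof.
move=> ab ch gh.
have ih : mu.-integrable `[a, b] (EFin \o h).
  by apply: continuous_compact_integrable => //; exact: segment_compact.
have ihoo : mu.-integrable `]a, b[ (EFin \o h).
  by apply: integrableS ih => //; exact: subset_itv_oo_cc.
have igoo : mu.-integrable `]a, b[ (EFin \o g).
  by apply: eq_integrable ihoo => // t /set_mem tab /=; rewrite gh.
have mg : measurable_fun `[a, b] g.
  apply: (@measurable_fun_itv_cc _ _ _ false true).
  by apply/measurable_EFinP; exact: measurable_int igoo.
split.
  apply/integrableP; split; first exact/measurable_EFinP.
  rewrite integral_itv_bndoo; first by have /integrableP[] := igoo.
  by apply: measurableT_comp => //; exact: measurable_int igoo.
have oo (f : R -> R) : mu.-integrable `]a, b[ (EFin \o f) ->
    (\int[mu]_(t in `[a, b]) (f t)%:E = \int[mu]_(t in `]a, b[) (f t)%:E)%E.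
  by move=> /(measurable_int mu); exact: integral_itv_bndoo.
rewrite /Rintegral (oo _ igoo) (oo _ ihoo).
by congr fine; apply: eq_integral => t /set_mem tab; rewrite gh.
Qed.

Lemma C1_segment_within g a b :
  C1_segment g a b -> {within `[a, b], continuous g}.
Proof. by move=> [/derivable_oo_LRcontinuous_within]. Qed.

Lemma C1_segment_integral g h a b : a < b -> C1_segment g a b ->
  {in `]a, b[, h =1 derive1 g} ->
  mu.-integrable `[a, b] (EFin \o h) /\
  \int[mu]_(t in `[a, b]) h t = g b - g a.
Proof.
move=> ab [dg [g' cg' gg']] hg.
have hg' : {in `]a, b[, h =1 g'} by move=> t tab; rewrite hg // gg'.
have [? ->] := integrable_itv_cc_oo ab cg' hg'; split=> //.
by rewrite /Rintegral (continuous_FTC2 ab cg' dg gg').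
Qed.

Lemma integrable_itv_cat h a b d : a <= b -> b <= d ->
  mu.-integrable `[a, b] (EFin \o h) -> mu.-integrable `[b, d] (EFin \o h) ->
  mu.-integrable `[a, d] (EFin \o h) /\
  \int[mu]_(t in `[a, d]) h t =
    \int[mu]_(t in `[a, b]) h t + \int[mu]_(t in `[b, d]) h t.
Proof.
move=> ab bd iab ibd.
have U : `[a, d]%classic = `[a, b]%classic `|` `]b, d]%classic.
  by apply: itv_bndbnd_setU; rewrite bnd_simp.
have ibd' : mu.-integrable `]b, d] (EFin \o h).
  by apply: integrableS ibd => //; exact: subset_itv_oc_cc.
have dis : [disjoint `[a, b]%classic & `]b, d]%classic].
  apply/disj_setPS => t [] /=; rewrite !in_itv /= => /andP[_ tb] /andP[bt _].
  by move: bt; rewrite ltNge tb.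
have mab : measurable_fun (`[a, b]%classic `|` `]b, d]%classic) (EFin \o h).
  by apply/measurable_funU => //; split; [exact: measurable_int iab|
    exact: measurable_int ibd'].
have iad : mu.-integrable `[a, d] (EFin \o h).
  rewrite U; apply/integrableP; split=> //.
  rewrite ge0_integral_setU //; last exact: measurableT_comp.
  by rewrite lte_add_pinfty //; [have /integrableP[] := iab|
    have /integrableP[] := ibd'].
split=> //; rewrite -(Rintegral_itv_obnd_cbnd ibd').
by rewrite -(Rintegral_itvB iad (x := b)) ?bnd_simp // addrC subrK.
Qed.

Lemma C1_segment_cst (k : R) a b : C1_segment (fun=> k) a b.
Proof.
split; first by split; [move=> x _; exact: derivable_cst|exact: cvg_cst..].
exists (fun=> 0); first by move=> x; exact: cvg_cst.
by move=> x _; rewrite derive1_cst.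
Qed.

Lemma C1_segmentD g h a b : C1_segment g a b -> C1_segment h a b ->
  C1_segment (g \+ h) a b /\
  {in `]a, b[, derive1 (g \+ h) =1 derive1 g \+ derive1 h}.
Proof.
move=> [[dg ga gb] [g' cg' gg']] [[dh ha hb] [h' ch' hh']].
have dgh : {in `]a, b[, derive1 (g \+ h) =1 derive1 g \+ derive1 h}.
  move=> x xab; rewrite /= !derive1E deriveD; [by []|exact: dg|exact: dh].
split; last exact: dgh.
split; last first.
  exists (g' \+ h'); first by move=> x; apply: cvgD; [exact: cg'|exact: ch'].
  by move=> x xab; rewrite dgh //= gg' // hh'.
split; [|exact: cvgD..].
by move=> x xab; apply: derivableD; [exact: dg|exact: dh].
Qed.

Lemma C1_segmentM g h a b : C1_segment g a b -> C1_segment h a b ->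
  C1_segment (g \* h) a b /\
  {in `]a, b[, derive1 (g \* h) =1 (derive1 g \* h) \+ (g \* derive1 h)}.
Proof.
move=> Cg Ch; have cg := C1_segment_within Cg; have ch := C1_segment_within Ch.
move: Cg Ch => [[dg ga gb] [g' cg' gg']] [[dh ha hb] [h' ch' hh']].
have dgh : {in `]a, b[,
    derive1 (g \* h) =1 (derive1 g \* h) \+ (g \* derive1 h)}.
  move=> x xab; rewrite /= !derive1E deriveM; [|exact: dg|exact: dh].
  by rewrite /GRing.scale /=; ring.
split; last exact: dgh.
split; last first.
  exists ((g' \* h) \+ (g \* h')).
    by move=> x; apply: cvgD; apply: cvgM;
      [exact: cg'|exact: ch|exact: cg|exact: ch'].
  by move=> x xab; rewrite dgh //= gg' // hh'.
split; [|exact: cvgM..].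
by move=> x xab; apply: derivableM; [exact: dg|exact: dh].
Qed.

Definition C1_arc F a b :=
  C1_segment (re_part F) a b /\ C1_segment (im_part F) a b.

Lemma C1_arc_cst (w : R[i]) a b : C1_arc (fun=> w) a b.
Proof. by split; exact: C1_segment_cst. Qed.

Lemma C1_arcD F G a b : C1_arc F a b -> C1_arc G a b ->
  C1_arc (fun t => F t + G t) a b /\
  {in `]a, b[, forall t,
    velocity (fun t => F t + G t) t = velocity F t + velocity G t}.
Proof.
move=> [F1 F2] [G1 G2].
have reE : re_part (fun t => F t + G t) = re_part F \+ re_part G.
  by apply/funext => t; rewrite /re_part /=; case: (F t) (G t) => ? ? [].
have imE : im_part (fun t => F t + G t) = im_part F \+ im_part G.
  by apply/funext => t; rewrite /im_part /=; case: (F t) (G t) => ? ? [].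
rewrite /C1_arc /velocity reE imE.
have [Cr dr] := C1_segmentD F1 G1; have [Ci di] := C1_segmentD F2 G2.
by split=> // t tab; rewrite dr // di.
Qed.

Lemma C1_arcM F G a b : C1_arc F a b -> C1_arc G a b ->
  C1_arc (fun t => F t * G t) a b /\
  {in `]a, b[, forall t, velocity (fun t => F t * G t) t =
    velocity F t * G t + F t * velocity G t}.
Proof.
move=> [F1 F2] [G1 G2].
(* The subtraction is written as addition of a multiple by [-1], so that the rules for sums and
   products suffice. *)
have reE : re_part (fun t => F t * G t) =
    (re_part F \* re_part G) \+ (cst (-1) \* (im_part F \* im_part G)).
  apply/funext => t; rewrite /re_part /im_part /=.
  by case: (F t) (G t) => ? ? [? ?] /=; rewrite mulN1r.
have imE : im_part (fun t => F t * G t) =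
    (re_part F \* im_part G) \+ (im_part F \* re_part G).
  by apply/funext => t; rewrite /re_part /im_part /=; case: (F t) (G t) => ? ? [].
rewrite /C1_arc /velocity reE imE.
have [Crr drr] := C1_segmentM F1 G1; have [Cii dii] := C1_segmentM F2 G2.
have [Cri dri] := C1_segmentM F1 G2; have [Cir dir] := C1_segmentM F2 G1.
have [Cm dm] := C1_segmentM (C1_segment_cst (-1) a b) Cii.
have [Cr dr] := C1_segmentD Crr Cm; have [Ci di] := C1_segmentD Cri Cir.
split=> // t tab.
rewrite dr // di //= drr // dm // dri // dir //= dii // derive1_cst /=.
rewrite /re_part /im_part; case: (F t) (G t) => x y [z w] /=.
by apply/eqP; rewrite eq_complex /=; apply/andP; split; apply/eqP; ring.
Qed.

Lemma C1_arc_horner F a b (P : {poly R[i]}) : C1_arc F a b ->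
  C1_arc (fun t => P.[F t]) a b /\
  {in `]a, b[, forall t,
    velocity (fun t => P.[F t]) t = P^`().[F t] * velocity F t}.
Proof.
move=> CF; elim/poly_ind: P => [|P w [CP dP]].
  have -> : (fun t => (0 : {poly R[i]}).[F t]) = fun=> 0.
    by apply/funext => t; rewrite horner0.
  split; first exact: C1_arc_cst.
  move=> t _; rewrite deriv0 horner0 mul0r /velocity.
  by rewrite /re_part /im_part /= !derive1_cst.
have -> : (fun t => (P * 'X + w%:P).[F t]) = fun t => P.[F t] * F t + w.
  by apply/funext => t; rewrite hornerMXaddC.
have [CM dM] := C1_arcM CP CF.
have [CD dD] := C1_arcD CM (C1_arc_cst w a b).
split=> // t tab; rewrite dD // dM // dP // derivD derivM derivX derivC.
rewrite !hornerE /velocity.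
have -> : derive1 (re_part (fun=> w)) t = 0 by rewrite /re_part derive1_cst.
have -> : derive1 (im_part (fun=> w)) t = 0 by rewrite /im_part derive1_cst.
by rewrite addr0; ring.
Qed.

Lemma C1_arc_bounded F a b : a < b -> C1_arc F a b ->
  exists M, forall t, t \in `[a, b] -> cnorm (F t) <= M.
Proof.
move=> ab [/C1_segment_within c1 /C1_segment_within c2].
have abs (g : R -> R) : {within `[a, b], continuous g} ->
    {within `[a, b], continuous (fun t => `|g t|)}.
  by move=> cg x; apply: cvg_norm; exact: cg.
have [t1 _ h1] := EVT_max (ltW ab) (abs _ c1).
have [t2 _ h2] := EVT_max (ltW ab) (abs _ c2).
exists (`|re_part F t1| + `|im_part F t2|) => t tab.
by apply: le_trans (cnorm_le_ReIm _) (lerD _ _); [exact: h1|exact: h2].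
Qed.

Lemma C1_arc_separated F a b p : a < b -> C1_arc F a b ->
  (forall t, t \in `[a, b] -> F t != p) ->
  exists2 d, 0 < d & forall t, t \in `[a, b] -> d <= cnorm (F t - p).
Proof.
move=> ab [/C1_segment_within c1 /C1_segment_within c2] Fp.
(* The squared distance is polynomial in the coordinates, hence continuous, and attains a
   minimum. *)
pose n2 t := (re_part F t - complex.Re p) ^+ 2 + (im_part F t - complex.Im p) ^+ 2.
have n2E t : n2 t = cnorm (F t - p) ^+ 2.
  by rewrite sqr_cnorm /n2 /re_part /im_part; case: (F t) (p) => ? ? [].
have cn2 : {within `[a, b], continuous n2}.
  by move=> x; apply: cvgD; apply: cvgM; apply: cvgB;
    try exact: cvg_cst; [exact: c1|exact: c1|exact: c2|exact: c2].
have [t0 t0ab h] := EVT_min (ltW ab) cn2.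
exists (cnorm (F t0 - p)) => [|t tab].
  by rewrite cnorm_gt0 subr_eq0 Fp.
by rewrite -(ler_pXn2r (n := 2)) ?nnegrE ?cnorm_ge0 // -!n2E h.
Qed.

Lemma C1_arc_measurable F a b : C1_arc F a b ->
  measurable_fun `[a, b] (re_part F) /\ measurable_fun `[a, b] (im_part F).
Proof.
move=> [/C1_segment_within c1 /C1_segment_within c2].
by split; apply: subspace_continuous_measurable_fun.
Qed.

End C1_arcs.

(** * Integrals along a closed contour *)

Section contours.
Local Open Scope classical_set_scope.
Local Open Scope ring_scope.
Local Open Scope complex_scope.
Variables (R : realType) (c : R -> R[i]).
Hypothesis c_closed : closed_contour c.
Implicit Types (a b : R) (f g h : R[i] -> R[i]) (p w v : R[i]).
Local Notation mu := (@lebesgue_measure R).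

(** Facts about the whole contour are obtained by gluing smooth arcs. Taking for [Q] a predicate of
    the parameter interval makes gluing a single implication. *)
Lemma contour_ind (Q : R -> R -> Prop) :
  (forall a b, a < b -> C1_arc c a b -> Q a b) ->
  (forall a b d, a < b -> b < d -> Q a b -> Q b d -> Q a d) -> Q 0 1.
Proof.
move=> Qarc Qcat.
have le_last (y : R) u : path <%R y u -> y <= last y u.
  elim: u y => //= z u IHu y /andP[yz /IHu]; exact/le_trans/ltW.
have Qlast (s : seq R) a : path <%R a s -> s != [::] ->
    (forall k, (k < size s)%N ->
      C1_arc c (nth 0 (a :: s) k) (nth 0 s k)) -> Q a (last a s).
  elim: s a => // x s IH a /= /andP[ax ps] _ arcs.
  have Qax : Q a x by apply: Qarc => //; exact: (arcs 0%N).
  have [s0|s0] := eqVneq s [::]; first by rewrite s0.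
  apply: (Qcat a x) => //; last first.
    by apply: (IH x ps s0) => k ks; exact: (arcs k.+1 ks).
  move: s0 ps; case: (s) => //= y u _ /andP[xy /le_last]; exact: lt_le_trans.
case: c_closed => _ [s [ps ls arcs]]; rewrite -[X in Q _ X]ls; apply: Qlast => //.
(* An empty list of break points would have last element [0] instead of [1]. *)
by apply: contra_eq_neq ls => ->; rewrite /= eq_sym oner_eq0.
Qed.

Lemma mem_itv_cat a b d t : t \in `[a, d] -> t \in `[a, b] \/ t \in `[b, d].
Proof.
rewrite !in_itv /= => /andP[-> ->]; rewrite !andbT.
by case: (leP t b) => [|/ltW]; [left|right].
Qed.

Lemma contour_bounded : exists r, forall t, t \in `[0, 1] -> cnorm (c t) <= r.
Proof.
apply: (contour_ind (Q := fun a b =>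
  exists r, forall t, t \in `[a, b] -> cnorm (c t) <= r)).
  exact: C1_arc_bounded.
move=> a b d _ _ [r hr] [r' hr']; exists (Num.max r r') => t.
by rewrite le_max => /(mem_itv_cat b)[/hr -> //|/hr' ->]; rewrite orbT.
Qed.

Lemma contour_separated p : off_contour c p ->
  exists2 d, 0 < d & forall t, t \in `[0, 1] -> d <= cnorm (c t - p).
Proof.
move=> cp.
apply: (contour_ind (Q := fun a b => (forall t, t \in `[a, b] -> c t != p) ->
  exists2 d, 0 < d & forall t, t \in `[a, b] -> d <= cnorm (c t - p))) => //.
  by move=> a b ab arc cp'; exact: C1_arc_separated.
move=> a b d ab bd Qab Qbd cp'.
have [|r r0 hr] := Qab.
  move=> t; rewrite in_itv /= => /andP[at_ tb]; apply: cp'.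
  by rewrite in_itv /= at_ (le_trans tb) // ltW.
have [|r' r'0 hr'] := Qbd.
  move=> t; rewrite in_itv /= => /andP[bt td]; apply: cp'.
  by rewrite in_itv /= td (le_trans _ bt) // ltW.
exists (Num.min r r') => [|t]; first by rewrite lt_min r0.
by rewrite ge_min => /(mem_itv_cat b)[/hr -> //|/hr' ->]; rewrite orbT.
Qed.

Lemma contour_measurable_horner (P : {poly R[i]}) :
  measurable_fun `[(0 : R), 1] (re_part (fun t => P.[c t])) /\
  measurable_fun `[(0 : R), 1] (im_part (fun t => P.[c t])).
Proof.
pose G t := P.[c t].
apply: (contour_ind (Q := fun a b =>
  measurable_fun `[a, b] (re_part G) /\ measurable_fun `[a, b] (im_part G))).
  by move=> a b ab /(C1_arc_horner P) [/C1_arc_measurable].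
move=> a b d ab bd [r1 i1] [r2 i2].
have -> : `[a, d]%classic = `[a, b]%classic `|` `[b, d]%classic.
  apply/seteqP; split=> t /=; first exact: mem_itv_cat.
  rewrite !in_itv /= => -[] /andP[h1 h2]; apply/andP; split=> //.
    by rewrite (le_trans h2) // ltW.
  by rewrite (le_trans _ h1) // ltW.
by split; apply/measurable_funU.
Qed.

(** The fundamental theorem of calculus applies on each arc, and the values at break points
    telescope. *)
Lemma contour_integrable_deriv (P : {poly R[i]}) :
  [/\ mu.-integrable `[0, 1]
        (EFin \o (fun t => complex.Re (P^`().[c t] * velocity c t))),
      mu.-integrable `[0, 1]
        (EFin \o (fun t => complex.Im (P^`().[c t] * velocity c t))) &
      contour_integral c (horner P^`()) = P.[c 1] - P.[c 0]].
Proof.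
pose G t := P.[c t]; pose f t := P^`().[c t] * velocity c t.
suff [[? re] [? im]] : (mu.-integrable `[0, 1] (EFin \o (@complex.Re R \o f)) /\
     \int[mu]_(t in `[0, 1]) complex.Re (f t) = re_part G 1 - re_part G 0) /\
    (mu.-integrable `[0, 1] (EFin \o (@complex.Im R \o f)) /\
     \int[mu]_(t in `[0, 1]) complex.Im (f t) = im_part G 1 - im_part G 0).
  split=> //; rewrite /contour_integral re im /re_part /im_part /G.
  by case: (P.[c 1]) (P.[c 0]) => ? ? [].
have seg a b : a < b -> C1_arc c a b ->
    (mu.-integrable `[a, b] (EFin \o (@complex.Re R \o f)) /\
     \int[mu]_(t in `[a, b]) complex.Re (f t) = re_part G b - re_part G a) /\
    (mu.-integrable `[a, b] (EFin \o (@complex.Im R \o f)) /\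
     \int[mu]_(t in `[a, b]) complex.Im (f t) = im_part G b - im_part G a).
  move=> ab /(C1_arc_horner P) [[C1 C2] dG].
  by split; apply: C1_segment_integral => // t tab; rewrite /= /f -dG.
apply: (contour_ind (Q := fun a b =>
    (mu.-integrable `[a, b] (EFin \o (@complex.Re R \o f)) /\
     \int[mu]_(t in `[a, b]) complex.Re (f t) = re_part G b - re_part G a) /\
    (mu.-integrable `[a, b] (EFin \o (@complex.Im R \o f)) /\
     \int[mu]_(t in `[a, b]) complex.Im (f t) = im_part G b - im_part G a))) => //.
move=> a b d /ltW ab /ltW bd [[r1 r1E] [i1 i1E]] [[r2 r2E] [i2 i2E]].
have [r3 r3E] := integrable_itv_cat ab bd r1 r2.
have [i3 i3E] := integrable_itv_cat ab bd i1 i2.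
split; split=> //.
  by rewrite r3E r1E r2E addrC subrKA.
by rewrite i3E i1E i2E addrC subrKA.
Qed.

Lemma antiderivative_poly (P : {poly R[i]}) : exists Q : {poly R[i]}, Q^`() = P.
Proof.
exists (\poly_(i < (size P).+1) (P`_i.-1 / i%:R)); apply/polyP => i.
rewrite coef_deriv coef_poly ltnS /=; case: ltnP => [_|/(nth_default 0) ->].
  by rewrite -[LHS]mulr_natr divfK // pnatr_eq0.
by rewrite mul0rn.
Qed.

(** Integrability travels with the value, since linearity of the integral requires it. *)
Definition has_cint f w :=
  [/\ mu.-integrable `[0, 1]
        (EFin \o (fun t => complex.Re (f (c t) * velocity c t))),
      mu.-integrable `[0, 1]
        (EFin \o (fun t => complex.Im (f (c t) * velocity c t))) &
      contour_integral c f = w].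

Lemma eq_has_cint f g w : (forall t, t \in `[0, 1] -> f (c t) = g (c t)) ->
  has_cint f w -> has_cint g w.
Proof.
move=> fg [fr fi <-]; split.
- by apply: eq_integrable fr => // t /set_mem /= t01; rewrite fg.
- by apply: eq_integrable fi => // t /set_mem /= t01; rewrite fg.
rewrite /contour_integral; congr (_ +i* _);
  by apply: eq_Rintegral => t /set_mem /= t01; rewrite fg.
Qed.

Lemma has_cintD f g w v : has_cint f w -> has_cint g v ->
  has_cint (fun z => f z + g z) (w + v).
Proof.
move=> [fr fi <-] [gr gi <-].
have reE t : complex.Re ((f (c t) + g (c t)) * velocity c t) =
   complex.Re (f (c t) * velocity c t) + complex.Re (g (c t) * velocity c t).
  by rewrite mulrDl; case: (f _ * _) (g _ * _) => ? ? [].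
have imE t : complex.Im ((f (c t) + g (c t)) * velocity c t) =
   complex.Im (f (c t) * velocity c t) + complex.Im (g (c t) * velocity c t).
  by rewrite mulrDl; case: (f _ * _) (g _ * _) => ? ? [].
split.
- by apply: eq_integrable (integrableD _ fr gr) => // t _; rewrite /= reE.
- by apply: eq_integrable (integrableD _ fi gi) => // t _; rewrite /= imE.
rewrite /contour_integral.
under eq_Rintegral do rewrite reE.
under [X in _ +i* X]eq_Rintegral do rewrite imE.
by rewrite !RintegralD.
Qed.

Lemma has_cintZ f w v : has_cint f w -> has_cint (fun z => v * f z) (v * w).
Proof.
move=> [fr fi <-].
have reE t : complex.Re (v * f (c t) * velocity c t) =
   complex.Re v * complex.Re (f (c t) * velocity c t) -
   complex.Im v * complex.Im (f (c t) * velocity c t).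
  by rewrite -mulrA; case: (v) (f _ * _) => ? ? [].
have imE t : complex.Im (v * f (c t) * velocity c t) =
   complex.Re v * complex.Im (f (c t) * velocity c t) +
   complex.Im v * complex.Re (f (c t) * velocity c t).
  by rewrite -mulrA; case: (v) (f _ * _) => ? ? [].
have iZ k (h : R -> R) : mu.-integrable `[0, 1] (EFin \o h) ->
  mu.-integrable `[0, 1] (EFin \o (fun t => k * h t)).
  by move=> ih; exact: (integrableZl _ k ih).
have := (iZ (complex.Re v) _ fr, iZ (complex.Im v) _ fi).
have := (iZ (complex.Re v) _ fi, iZ (complex.Im v) _ fr).
move=> [v1 v2] [v3 v4]; split.
- by apply: eq_integrable (integrableB _ v3 v4) => // t _; rewrite /= reE.
- by apply: eq_integrable (integrableD _ v1 v2) => // t _; rewrite /= imE.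
rewrite /contour_integral.
under eq_Rintegral do rewrite reE.
under [X in _ +i* X]eq_Rintegral do rewrite imE.
rewrite RintegralB // RintegralD // !RintegralZl //.
by case: (v).
Qed.

Lemma has_cint_horner (P : {poly R[i]}) : has_cint (horner P) 0.
Proof.
have [Q <-] := antiderivative_poly P.
have [h1 h2 h3] := contour_integrable_deriv Q; split=> //.
by rewrite h3; case: c_closed => -> _; rewrite subrr.
Qed.

Lemma has_cint_sum (I : Type) (s : seq I) (f : I -> R[i] -> R[i]) (w : I -> R[i]) :
  (forall i, has_cint (f i) (w i)) ->
  has_cint (fun z => \sum_(i <- s) f i z) (\sum_(i <- s) w i).
Proof.
move=> fw; elim: s => [|i s IH].
  rewrite big_nil; apply: eq_has_cint (has_cint_horner 0) => t _.
  by rewrite big_nil horner0.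
rewrite big_cons; apply: eq_has_cint (has_cintD (fw i) IH) => t _.
by rewrite big_cons.
Qed.

(** The sum norm replaces the modulus of the velocity: its integrability follows at once from that
    of the two components, and constant factors do not matter in the estimates. *)
Definition speed (t : R) : R :=
  `|complex.Re (velocity c t)| + `|complex.Im (velocity c t)|.

Lemma integrable_velocity :
  mu.-integrable `[0, 1] (EFin \o (fun t => complex.Re (velocity c t))) /\
  mu.-integrable `[0, 1] (EFin \o (fun t => complex.Im (velocity c t))).
Proof.
have [vr vi _] := has_cint_horner 1.
by split; [apply: eq_integrable vr|apply: eq_integrable vi] => // t _ /=;
  rewrite hornerC mul1r.
Qed.

Lemma integrable_speed : mu.-integrable `[0, 1] (EFin \o speed).
Proof.
have [vr vi] := integrable_velocity.
exact: (integrableD _ (integrable_abse vr) (integrable_abse vi)).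
Qed.

Lemma Re_mul_velocity_le w (M t : R) : cnorm w <= M ->
  `|complex.Re (w * velocity c t)| <= M * speed t.
Proof.
move=> wM; have -> : complex.Re (w * velocity c t) =
    complex.Re w * complex.Re (velocity c t) -
    complex.Im w * complex.Im (velocity c t).
  by case: (w) (velocity c t) => ? ? [].
rewrite /speed mulrDr; apply: le_trans (ler_normB _ _) _.
by rewrite !normrM lerD // ler_wpM2r //;
  [exact: le_trans (Re_le_cnorm _) wM|exact: le_trans (Im_le_cnorm _) wM].
Qed.

Lemma Im_mul_velocity_le w (M t : R) : cnorm w <= M ->
  `|complex.Im (w * velocity c t)| <= M * speed t.
Proof.
move=> wM; have -> : complex.Im (w * velocity c t) =
    complex.Im w * complex.Re (velocity c t) +
    complex.Re w * complex.Im (velocity c t).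
  by case: (w) (velocity c t) => ? ? [? ?] /=; rewrite addrC.
rewrite /speed mulrDr; apply: le_trans (ler_normD _ _) _.
by rewrite !normrM lerD // ler_wpM2r //;
  [exact: le_trans (Im_le_cnorm _) wM|exact: le_trans (Re_le_cnorm _) wM].
Qed.

Lemma has_cint_bounded f (M : R) :
  measurable_fun `[(0 : R), 1] (fun t => complex.Re (f (c t))) ->
  measurable_fun `[(0 : R), 1] (fun t => complex.Im (f (c t))) ->
  (forall t, t \in `[0, 1] -> cnorm (f (c t)) <= M) ->
  has_cint f (contour_integral c f).
Proof.
move=> mr mi fM; have [vr vi] := integrable_velocity.
have /measurable_EFinP mvr := measurable_int _ vr.
have /measurable_EFinP mvi := measurable_int _ vi.
have iMs : mu.-integrable `[0, 1] (EFin \o (fun t => M * speed t)).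
  exact: (integrableZl _ M integrable_speed).
have speed_ge0 t : 0 <= speed t by rewrite addr_ge0.
have M_ge0 (t : R) : t \in `[0, 1] -> 0 <= M.
  by move=> t01; exact: le_trans (cnorm_ge0 _) (fM t t01).
split=> //.
- apply: le_integrable iMs => //.
    apply/measurable_EFinP.
    apply: (eq_measurable_fun (fun t =>
      complex.Re (f (c t)) * complex.Re (velocity c t) -
      complex.Im (f (c t)) * complex.Im (velocity c t))).
      by move=> t _; case: (f (c t)) (velocity c t) => ? ? [].
    by apply: measurable_funB; apply: measurable_funM.
  move=> t t01 /=; rewrite lee_fin [leRHS]ger0_norm.
    exact: Re_mul_velocity_le (fM _ t01).
  by rewrite mulr_ge0 // (M_ge0 t).
- apply: le_integrable iMs => //.
    apply/measurable_EFinP.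
    apply: (eq_measurable_fun (fun t =>
      complex.Re (f (c t)) * complex.Im (velocity c t) +
      complex.Im (f (c t)) * complex.Re (velocity c t))).
      by move=> t _; case: (f (c t)) (velocity c t) => ? ? [].
    by apply: measurable_funD; apply: measurable_funM.
  move=> t t01 /=; rewrite lee_fin [leRHS]ger0_norm.
    exact: Im_mul_velocity_le (fM _ t01).
  by rewrite mulr_ge0 // (M_ge0 t).
Qed.

Lemma contour_integral_le f w (M : R) : has_cint f w ->
  (forall t, t \in `[0, 1] -> cnorm (f (c t)) <= M) ->
  cnorm w <= 2 * (M * \int[mu]_(t in `[0, 1]) speed t).
Proof.
move=> [fr fi <-] fM; apply: le_trans (cnorm_le_ReIm _) _.
rewrite mulr_natl mulr2n /contour_integral /=.
rewrite -RintegralZl //; last exact: integrable_speed.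
have iMs : mu.-integrable `[0, 1] (EFin \o (fun t => M * speed t)).
  exact: (integrableZl _ M integrable_speed).
apply: lerD.
  apply: le_trans (le_normr_Rintegral _ fr) _ => //.
  apply: le_Rintegral => //; first exact: (integrable_abse fr).
  by move=> t t01; exact: Re_mul_velocity_le (fM _ t01).
apply: le_trans (le_normr_Rintegral _ fi) _ => //.
apply: le_Rintegral => //; first exact: (integrable_abse fi).
by move=> t t01; exact: Im_mul_velocity_le (fM _ t01).
Qed.

(** Along [c], [h] is a pointwise limit of polynomials, hence measurable, and it is bounded, hence
    integrable. Polynomials have integral 0, so the integral of [h] equals that of [h - Q] for every
    polynomial [Q], which is arbitrarily small. *)
Lemma has_cint_poly_approx (S : set R[i]) h :
  (forall t, t \in `[0, 1] -> S (c t)) -> poly_approx S h -> has_cint h 0.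
Proof.
move=> Sc ah.
have [r hr] := contour_bounded.
pose S' := [set z | exists2 t, t \in `[0, 1] & z = c t].
have ah' : poly_approx S' h.
  by move=> e /ah [P hP]; exists P => z [t t01 ->]; exact: hP (Sc _ t01).
have S'r z : S' z -> cnorm z <= r by move=> [t t01 ->]; exact: hr.
have [M M0 hM] := poly_approx_bounded S'r ah'.
have cS' t : t \in `[0, 1] -> S' (c t) by exists t.
have /choice [P hP] : forall n, exists P : {poly R[i]}, forall t, t \in `[0, 1] ->
    cnorm (h (c t) - P.[c t]) <= n.+1%:R^-1.
  move=> n; have [|P hP] := ah' (n.+1%:R^-1); first by rewrite invr_gt0.
  by exists P => t t01; exact: hP (cS' _ t01).
have Hh : has_cint h (contour_integral c h).
  apply: (@has_cint_bounded _ M); last by move=> t /cS'; exact: hM.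
    apply: (@measurable_fun_cvg _ _ _ _ (fun n t => complex.Re (P n).[c t])).
      by move=> n; have [] := contour_measurable_horner (P n).
    move=> t t01; apply/cvgrPdist_le => e e0.
    have := @near_infty_natSinv_lt R (PosNum e0); apply: filterS => n /= ne.
    rewrite -raddfB /=.
    apply: le_trans (Re_le_cnorm _) _; apply: le_trans (hP n t t01) _.
    exact: ltW.
  apply: (@measurable_fun_cvg _ _ _ _ (fun n t => complex.Im (P n).[c t])).
    by move=> n; have [] := contour_measurable_horner (P n).
  move=> t t01; apply/cvgrPdist_le => e e0.
  have := @near_infty_natSinv_lt R (PosNum e0); apply: filterS => n /= ne.
  rewrite -raddfB /=.
  apply: le_trans (Im_le_cnorm _) _; apply: le_trans (hP n t t01) _.
  exact: ltW.
suff w0 : contour_integral c h = 0 by rewrite -w0.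
apply/eqP; rewrite -cnorm_eq0 eq_le cnorm_ge0 andbT.
set L := \int[mu]_(t in `[0, 1]) speed t.
have L0 : 0 <= L.
  by apply: Rintegral_ge0 => t _; rewrite addr_ge0.
apply/ler_addgt0Pl => e e0; rewrite addr0.
(* [L] is [0] for a constant contour, hence the denominator [L + 1]. *)
have d0 : 0 < e / (2 * (L + 1)) by rewrite divr_gt0 // mulr_gt0 // ltr_wpDl.
have [Q hQ] := ah' _ d0.
have HQ := has_cintD Hh (has_cintZ (-1) (has_cint_horner Q)).
rewrite mulr0 addr0 in HQ.
apply: le_trans (contour_integral_le (M := e / (2 * (L + 1))) HQ _) _.
  by move=> t t01; rewrite mulN1r; exact: hQ (cS' _ t01).
rewrite -/L; have L1 : 0 < L + 1 by rewrite ltr_wpDl.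
have -> : 2 * (e / (2 * (L + 1)) * L) = e * (L / (L + 1)).
  by field; rewrite gt_eqF.
by rewrite ler_piMr ?(ltW e0) // ler_pdivrMr // mul1r lerDl.
Qed.

Lemma has_cint_inv p : off_contour c p ->
  has_cint (fun z => (z - p)^-1) (contour_integral c (fun z => (z - p)^-1)).
Proof.
move=> cp; have [d d0 hd] := contour_separated cp.
have [mr mi] := contour_measurable_horner ('X - p%:P).
pose n2 t := re_part (fun t => ('X - p%:P).[c t]) t ^+ 2 +
  im_part (fun t => ('X - p%:P).[c t]) t ^+ 2.
have mn : measurable_fun `[(0 : R), 1] (fun t => (n2 t)^-1).
  (* As [n2] is nonnegative, its inverse is a real power, and real powers are measurable. *)
  apply: (eq_measurable_fun (fun t => n2 t `^ (-1))).
    by move=> t _; rewrite powR_inv1 // addr_ge0 ?sqr_ge0.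
  apply: (measurableT_comp (measurable_powR (-1))).
  by apply: measurable_funD; apply: measurable_funX.
apply: (@has_cint_bounded _ d^-1).
- apply: (eq_measurable_fun _ _ (measurable_funM mr mn)) => t _.
  by rewrite /= /n2 /re_part /im_part /= !hornerE; case: (c t - p) => ? ?.
- apply: (eq_measurable_fun _ _ (measurable_funN (measurable_funM mi mn))) => t _.
  by rewrite /= /n2 /re_part /im_part /= !hornerE; case: (c t - p) => ? ?.
- by move=> t /hd dle; rewrite cnormV lef_pV2 ?posrE // (lt_le_trans d0).
Qed.

(* The error term [(h z - h p) / (z - p)] is again a uniform limit of
   polynomials, so that only [h p / (z - p)] contributes. *)
Lemma has_cint_div (S : set R[i]) p h : off_contour c p ->
  S p -> (forall t, t \in `[0, 1] -> S (c t)) -> poly_approx S h ->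
  has_cint (fun z => h z / (z - p))
    (h p * contour_integral c (fun z => (z - p)^-1)).
Proof.
move=> cp Sp Sc ah; have [d d0 hd] := contour_separated cp.
pose S' := [set z | S z /\ d <= cnorm (z - p)].
have aq : poly_approx S' (fun z => (h z - h p) / (z - p)).
  exact: poly_approx_divided_difference d0 _ Sp ah.
have Hq : has_cint (fun z => (h z - h p) / (z - p)) 0.
  by apply: has_cint_poly_approx aq => t t01; split; [exact: Sc|exact: hd].
have := has_cintD Hq (has_cintZ (h p) (has_cint_inv cp)); rewrite add0r.
by apply: eq_has_cint => t _; rewrite mulrBl subrK.
Qed.

End contours.

(** * Residues of the exponential kernel *)

Section exponential_kernel.
Local Open Scope classical_set_scope.
Local Open Scope ring_scope.
Local Open Scope complex_scope.
Variables (R : realType) (c : R -> R[i]) (a : R[i]) (l : R).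
Hypothesis c_closed : closed_contour c.
Implicit Types (b y : R) (z p : R[i]).

Local Notation I p := (contour_integral c (fun z => (z - p)^-1)).

(* The bound on [b * y] makes the centre [l +i* y] the pole nearest to the real
   axis. *)
Definition residue_formula b := forall y, `|b * y| <= pi ->
  (forall p, cexp (b%:C * (p - (l +i* y))) = 1 -> off_contour c p) ->
  (forall p, cexp (b%:C * (p - (l +i* y))) = 1 -> p != l +i* y -> I p = 0) ->
  has_cint c (fun z => cexp (a * z) / (1 - cexp (- (b%:C * (z - (l +i* y))))))
    (cexp (a * (l +i* y)) / b%:C * I (l +i* y)).

(** With [E = cexp (- (b / 2 * (z - z0)))], the function [1 / (1 + E)] is the halved kernel centred
    at [z1], because translation by half a period of [E] flips its sign. As [z1] is a pole of the
    original kernel other than [z0], [out] makes its contribution vanish. *)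
Lemma residue_formula_half b : b != 0 ->
  residue_formula (b / 2) -> residue_formula b.
Proof.
move=> b0 H y by_pi off out.
(* The sign of [b * y] is chosen so that [b / 2 * y1 = b * y / 2 - s * pi] remains between [- pi]
   and [pi]. *)
pose s : R := if 0 <= b * y then 1 else -1.
pose y1 := y - s * (2 * pi / b).
have y1_pi : `|b / 2 * y1| <= pi.
  have -> : b / 2 * y1 = b * y / 2 - s * pi by rewrite /y1; field.
  have := pi_ge0 R; move: by_pi; rewrite !ler_norml /s => /andP[h1 h2] pi0.
  by case: (leP 0 (b * y)) => h; apply/andP; split; lra.
have y_pi : `|b / 2 * y| <= pi.
  have := pi_ge0 R; move: by_pi; rewrite mulrAC !ler_norml => /andP[h1 h2] pi0.
  by apply/andP; split; lra.
set z0 := l +i* y in off out *; pose z1 := l +i* y1.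
have bC : b%:C != 0 by rewrite (inj_eq (@complexI R)).
have b2C : (b / 2)%:C = b%:C / 2 by rewrite rmorphM fmorphV /= rmorph_nat.
have one_neqN1 : (1 : R[i]) != -1.
  by rewrite -subr_eq0 opprK -mulr2n pnatr_eq0.
have cexp2 z : cexp (b%:C * z) = cexp ((b / 2)%:C * z) ^+ 2.
  by rewrite -cexpMn b2C -mulr_natr; congr cexp; field.
have z01 : cexp ((b / 2)%:C * (z1 - z0)) = -1.
  have -> : (b / 2)%:C * (z1 - z0) = 0 +i* (- (s * pi)).
    apply/eqP; rewrite eq_complex /= /y1; apply/andP; split; apply/eqP; first by ring.
    by field.
  rewrite /cexp /= expR0 !mul1r cosN sinN /s; case: ifP => _.
    by rewrite !mul1r cospi sinpi oppr0; apply/eqP; rewrite eq_complex /= oppr0 !eqxx.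
  by rewrite !mulN1r cosN sinN cospi sinpi !oppr0; apply/eqP; rewrite eq_complex /= oppr0 !eqxx.
have shift p : cexp ((b / 2)%:C * (p - z0)) = - cexp ((b / 2)%:C * (p - z1)).
  rewrite -[RHS]mulrN1 -z01 -cexpD; congr cexp; ring.
have H0 := H y y_pi; have H1 := H y1 y1_pi.
rewrite -/z0 in H0; rewrite -/z1 in H1.
have {}H0 : has_cint c
    (fun z => cexp (a * z) / (1 - cexp (- ((b / 2)%:C * (z - z0)))))
    (cexp (a * z0) / (b / 2)%:C * I z0).
  apply: H0 => p p0; first by apply: off; rewrite cexp2 p0 expr1n.
  by apply: out; rewrite cexp2 p0 expr1n.
have Iz1 : I z1 = 0.
  apply: out; first by rewrite cexp2 z01 sqrrN expr1n.
  by apply: contra_eq_neq z01 => ->; rewrite subrr mulr0 cexp0.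
have {}H1 : has_cint c
    (fun z => cexp (a * z) / (1 - cexp (- ((b / 2)%:C * (z - z1))))) 0.
  rewrite Iz1 mulr0 in H1; apply: H1 => p p1.
    by apply: off; rewrite cexp2 shift p1 sqrrN expr1n.
  (* [z0] is not among the poles of the kernel centred at [z1], so [out] applies to all of these. *)
  move=> _; apply: out; first by rewrite cexp2 shift p1 sqrrN expr1n.
  apply: contra_eq_neq p1 => ->; rewrite -[z0 - z1]opprB mulrN cexpN z01.
  by rewrite invrN1 eq_sym.
have := has_cintZ (2^-1) (has_cintD H0 H1); rewrite addr0.
have -> : 2^-1 * (cexp (a * z0) / (b / 2)%:C * I z0) = cexp (a * z0) / b%:C * I z0.
  by rewrite b2C; field.
apply: eq_has_cint => t t01.
set E := cexp (- ((b / 2)%:C * (c t - z0))).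
have -> : cexp (- ((b / 2)%:C * (c t - z1))) = - E.
  by rewrite cexpN -[cexp (_ * (c t - z1))]opprK -shift invrN -cexpN.
have -> : cexp (- (b%:C * (c t - z0))) = E ^+ 2.
  by rewrite cexpN cexp2 -exprVn -cexpN.
have E2 : E ^+ 2 != 1.
  apply: contraT => /negPn/eqP E1.
  have /off /(_ t t01) : cexp (b%:C * (c t - z0)) = 1.
    by rewrite cexp2 -[cexp _]invrK -cexpN exprVn -/E E1 invr1.
  by rewrite eqxx.
have E1 : 1 - E != 0.
  by rewrite subr_eq0; apply: contraNneq E2 => <-; rewrite expr1n.
have E1' : 1 - - E != 0.
  by rewrite subr_eq0; apply: contraNneq E2 => e; rewrite -sqrrN -e expr1n.
by field; rewrite E1 opprK in E1' *; rewrite E1' subr_eq0 eq_sym E2.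
Qed.

Lemma residue_formula_small : exists2 eta, 0 < eta &
  forall b, b != 0 -> `|b| <= eta -> residue_formula b.
Proof.
have [r0 hr0] := contour_bounded c_closed.
pose r := `|r0| + `|l| + 1.
have r_gt0 : 0 < r by rewrite ltr_wpDl // addr_ge0.
have hr t : t \in `[0, 1] -> cnorm (c t - l%:C) <= r.
  move=> t01; apply: le_trans (cnormB _ _) _; rewrite cnorm_real.
  rewrite /r -addrA lerD ?(le_trans (hr0 t t01)) ?ler_norm //.
  by rewrite lerDl.
(* [k] is a lower bound for [1 - cos (b * y)] once [|b * y|] lies between [1 / 16] and [pi]. *)
pose k : R := 1 - cos (1 / 16).
have k_gt0 : 0 < k.
  have pi2 := pi_ge2 R; rewrite subr_gt0 -[ltRHS](@cos0 R).
  by rewrite ltr_cos ?in_itv /=; lra.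
(* [m] will bound [|b| * r]: [1 / 32] keeps the exponents small, and [k / 4] limits the perturbation
   of [1 - th] below to half its size. *)
pose m : R := Num.min (1 / 32) (k / 4).
have m32 : m <= 1 / 32 by rewrite /m ge_min lexx.
have mk : m <= k / 4 by rewrite /m ge_min lexx orbT.
have m_gt0 : 0 < m by rewrite /m lt_min !divr_gt0.
exists (m / r) => [|b b0]; first by rewrite divr_gt0.
rewrite ler_pdivlMr // => br y by_pi off out.
set z0 := l +i* y in off out *.
have bC : b%:C != 0 by rewrite (inj_eq (@complexI R)).
have z0l : z0 - l%:C = 0 +i* y.
  by apply/eqP; rewrite eq_complex /= subrr subr0 !eqxx.
have cnz0l : cnorm (z0 - l%:C) = `|y|.
  by rewrite z0l /cnorm normc_def /= expr0n add0r sqrtr_sqr.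
have off0 : off_contour c z0 by apply: off; rewrite subrr mulr0 cexp0.
have [near|far] := leP (`|b * y|) (1 / 16).
  have near' := near; rewrite normrM in near'.
  (* The centre is added to the contour because the residue is the value of [h] there. *)
  pose S := [set z | z = z0 \/ exists2 t, t \in `[0, 1] & z = c t].
  have Sc t : t \in `[0, 1] -> S (c t) by right; exists t.
  (* The bound comes from [1 / 32 + 1 / 16 <= 1 / 8]. By [expquot_near1] the quotient is then within
     [1 / 2] of [1], as its Neumann series requires. *)
  have Su z : S z -> cnorm (b%:C * (z - z0)) <= 1 / 8.
    case=> [->|[t t01 ->]]; first by rewrite subrr mulr0 cnorm0; lra.
    rewrite cnormM cnorm_real.
    have le1 : cnorm (c t - z0) <= r + `|y|.
      rewrite -(subrKA l%:C) -cnz0l [cnorm (z0 - _)]cnormBC.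
      exact: le_trans (cnormD _ _) (lerD (hr t t01) _).
    by have := normr_ge0 b; clear -le1 near' br m32; nra.
  have Sr z : S z -> cnorm z <= `|r0| + cnorm z0.
    case=> [->|[t t01 ->]]; first by rewrite lerDr.
    apply: le_trans (hr0 t t01) _; apply: le_trans (ler_norm _) _.
    by rewrite lerDl cnorm_ge0.
  have [d d0 hd] := contour_separated c_closed off0.
  have Sd z : S z -> z != z0 -> d <= cnorm (z - z0).
    by case=> [->|[t t01 ->]]; [rewrite eqxx|move=> _; exact: hd].
  pose h z := cexp (a * z + 0) * ((expquot (b%:C * (z - z0)))^-1 * b%:C^-1).
  have ah : poly_approx S h.
    apply: (poly_approxM Sr); first exact: (poly_approx_cexp Sr).
    apply: (poly_approxM Sr); last exact: poly_approx_cst.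
    apply: (@poly_approxV _ _ _ Sr _ 1 (1 / 2)); rewrite ?oner_neq0 //; first lra.
      move=> z /Su u8; apply: le_trans (expquot_near1 _) _; first lra.
      by rewrite cnorm1; lra.
    exact: (poly_approx_expquot d0 bC Sr Sd).
  have := has_cint_div c_closed off0 (or_introl erefl : S z0) Sc ah.
  have -> : h z0 = cexp (a * z0) / b%:C.
    by rewrite /h subrr mulr0 addr0 /expquot eqxx invr1 mul1r.
  apply: eq_has_cint => t t01.
  by rewrite /h addr0 -expquotM !invfM; ring.
pose S := [set z | exists2 t, t \in `[0, 1] & z = c t].
have Sc t : t \in `[0, 1] -> S (c t) by exists t.
have Sr z : S z -> cnorm z <= r0 by case=> t t01 ->; exact: hr0.
(* [|b| * r <= 1 / 32] and [1 / 16 < |b * y|] give [2 * r <= |y|]: around [l], the contour stays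
   within half the distance to [z0], so [(z - z0)^-1] is a Neumann series there. *)
have I0 : I z0 = 0.
  have ai : poly_approx S (fun z => (1 * z - z0)^-1).
    apply: (@poly_approxV _ _ _ Sr _ (l%:C - z0) (1 / 2)); last exact: poly_approx_affine.
    - by rewrite -cnorm_gt0 cnormBC cnz0l; apply: contraTT far => /=;
        rewrite normr_gt0 negbK => /eqP ->; rewrite mulr0 normr0 -leNgt; lra.
    - lra.
    move=> z [t t01 ->].
    have -> : 1 * c t - z0 - (l%:C - z0) = c t - l%:C by ring.
    rewrite [cnorm (l%:C - z0)]cnormBC cnz0l; apply: le_trans (hr t t01) _.
    rewrite normrM in far; have := normr_ge0 b; have := normr_ge0 y.
    clear -far br m32 r_gt0; nra.
  have [_ _ <-] := has_cint_poly_approx c_closed Sc ai.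
  by apply: f_equal; apply/funext => z; rewrite mul1r.
rewrite I0 mulr0.
pose th := cexp (b%:C * (0 +i* y)).
have th_ge : k <= cnorm (1 - th).
  apply: le_trans (Re_le_cnorm _); apply: le_trans (ler_norm _).
  rewrite /th /cexp /= !mul0r !mulr0 subr0 expR0 mul1r addr0 lerD2l lerN2.
  rewrite -(cos_norm (b * y)) leNgt ltr_cos -?leNgt ?(ltW far) //.
    by rewrite in_itv /= normr_ge0.
  by rewrite in_itv /=; have := pi_ge2 R; lra.
(* The exponent has norm at most [m], so the denominator differs from [1 - th] by at most
   [2 * m <= k / 2], half the lower bound for [cnorm (1 - th)]. *)
have ak : poly_approx S (fun z => (1 + - th * cexp (- b%:C * z + b%:C * l%:C))^-1).
  apply: (@poly_approxV _ _ _ Sr _ (1 - th) (1 / 2)); first by rewrite -cnorm_gt0 (lt_le_trans k_gt0).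
  - lra.
  - move=> z [t t01 ->].
    set u := - b%:C * c t + _; have u_le : cnorm u <= `|b| * r.
      have -> : u = - (b%:C * (c t - l%:C)) by rewrite /u; ring.
      by rewrite cnormN cnormM cnorm_real ler_wpM2l ?hr.
    have -> : 1 + - th * cexp u - (1 - th) = - th * (cexp u - 1) by ring.
    rewrite cnormM cnormN.
    have -> : cnorm th = 1.
      by rewrite /th cnorm_cexp /= mul0r mulr0 subr0 expR0.
    have [|h _] := @cexp_near1 _ u; first lra.
    by rewrite mul1r; lra.
  apply: poly_approxD; first exact: poly_approx_cst.
  apply: (poly_approxM Sr); first exact: poly_approx_cst.
  exact: (poly_approx_cexp Sr).
have aek := poly_approxM Sr (poly_approx_cexp Sr a 0) ak.
apply: eq_has_cint (has_cint_poly_approx c_closed Sc aek) => t t01.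
rewrite addr0 mulNr -cexpD; congr (_ / (1 - cexp _)).
have -> : z0 = l%:C + 0 +i* y by rewrite -z0l addrC subrK.
by ring.
Qed.

(** The threshold [eta] depends neither on [b] nor on the height of the centre, so it survives the
    halvings although they move the centre; enough of them bring [b] below it. *)
Lemma residue_formulaT b : b != 0 -> residue_formula b.
Proof.
move=> b0; have [eta eta0 small] := residue_formula_small.
suff [n hn] : exists n, `|b / 2 ^+ n| <= eta.
  elim: n b b0 hn => [|n IH] b b0 hn.
    by apply: small => //; rewrite expr0 divr1 in hn.
  apply: residue_formula_half => //; apply: IH.
    by rewrite mulf_neq0 ?invr_eq0 ?pnatr_eq0.
  by rewrite -mulrA -invfM -exprS.
have h0 : 0 <= 1 / 2 :> R by lra.
have h1 : 1 / 2 < 1 :> R by lra.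
have [|n hn] := exprn_lt_eventually h0 h1 (_ : 0 < eta / `|b|).
  by rewrite divr_gt0 // normr_gt0.
exists n; rewrite normrM normfV normrX [`|2|]gtr0_norm // mulrC.
by rewrite -ler_pdivlMr ?normr_gt0 // -exprVn -[2^-1]div1r.
Qed.

End exponential_kernel.

(** * Partial fractions and poles of the integrand *)

(** This is Lagrange interpolation of the constant [1] at the nodes [r i], divided by the full
    product: the difference [P] has degree at most [n] and [n.+1] roots. *)
Lemma inv_prod_partial_fractions (F : fieldType) (n : nat) (r : 'I_n.+1 -> F)
    (w : F) :
  (forall i j, i != j -> r i != r j) -> (forall i, w != r i) ->
  (\prod_i (w - r i))^-1 =
  \sum_i (\prod_(j | j != i) (r i - r j))^-1 * (w - r i)^-1.
Proof.
move=> r_inj wr.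
pose k i := (\prod_(j | j != i) (r i - r j))^-1.
have k0 i : \prod_(j | j != i) (r i - r j) != 0.
  by apply/prodf_neq0 => j ji; rewrite subr_eq0 r_inj // eq_sym.
pose P : {poly F} := \sum_i k i *: \prod_(j | j != i) ('X - (r j)%:P) - 1.
have P0 : P = 0.
  apply: (@roots_geq_poly_eq0 _ _ (codom r)).
  - apply/allP => _ /codomP [i ->]; rewrite rootE /P !hornerE horner_sum.
    rewrite (bigD1 i) //= hornerZ horner_prod [X in _ + X - 1]big1 => [|j ji].
      rewrite addr0 (eq_bigr (fun j => r i - r j)); last by move=> j _; rewrite hornerXsubC.
      by rewrite /k mulVf // subrr.
    rewrite hornerZ horner_prod (bigD1 i) //=; last by rewrite eq_sym.
    by rewrite hornerXsubC subrr mul0r mulr0.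
  - rewrite map_inj_uniq ?enum_uniq // => i j /eqP rij; apply/eqP.
    by apply: contraTT rij; exact: r_inj.
  - rewrite size_codom card_ord; apply: leq_trans (size_polyD _ _) _.
    rewrite size_polyN size_poly1 geq_max ltnS leq0n andbT.
    apply: leq_trans (size_sum _ _ _) _; apply/bigmax_leqP => i _.
    apply: leq_trans (size_scale_leq _ _) _.
    rewrite -(big_enum _ _ (predC1 i)) size_prod_XsubC.
    by rewrite -cardE cardC1 card_ord.
have /(congr1 (horner^~ w)) := P0; rewrite /P !hornerE horner_sum => /eqP.
rewrite subr_eq0 => /eqP sum1.
rewrite -[LHS]mul1r -[X in X * _]sum1 mulr_suml; apply: eq_bigr => i _.
rewrite hornerZ horner_prod -/(k i) -mulrA; congr (_ * _).
have w0 : \prod_(j | j != i) (w - r j) != 0.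
  by apply/prodf_neq0 => j _; rewrite subr_eq0.
rewrite (eq_bigr (fun j => w - r j)); last by move=> j _; rewrite hornerXsubC.
by rewrite [X in _ * X^-1](bigD1 i) //= invfM mulrCA mulfV // mulr1.
Qed.

(** * Poles of the integrand *)

Section poles.
Local Open Scope classical_set_scope.
Local Open Scope ring_scope.
Local Open Scope complex_scope.
Variable R : realType.
Implicit Types (p z w v : R[i]).

(** Punctured neighbourhoods with a real radius, which allows real estimates;
    [eventually_near_is_pole] returns to the filter, whose radii are complex. *)
Definition eventually_near p (P : R[i] -> Prop) :=
  exists2 d : R, 0 < d & forall z, z != p -> cnorm (z - p) <= d -> P z.

Lemma eventually_near_and p P Q : eventually_near p P -> eventually_near p Q ->
  eventually_near p (fun z => P z /\ Q z).
Proof.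
move=> [d d0 hd] [e e0 he]; exists (Num.min d e); first by rewrite lt_min d0.
by move=> z zp; rewrite le_min => /andP[/(hd _ zp) ? /(he _ zp) ?].
Qed.

Lemma eventually_near_all p (I : finType) (P : I -> R[i] -> Prop) :
  (forall i, eventually_near p (P i)) ->
  eventually_near p (fun z => forall i, P i z).
Proof.
move=> H; suff : eventually_near p (fun z => forall i, i \in enum I -> P i z).
  by move=> [d d0 hd]; exists d => // z zp zd i; apply: hd => //; rewrite mem_enum.
elim: (enum I) => [|i s IH]; first by exists 1.
have [d d0 hd] := eventually_near_and (H i) IH; exists d => // z zp zd j.
by rewrite in_cons => /orP[/eqP ->|]; have [? hs] := hd z zp zd; [|exact: hs].
Qed.

Lemma eventually_near_cexp p w : eventually_near p (fun z =>
  cnorm (cexp (w * (z - p)) - 1) <= 2 * cnorm w * cnorm (z - p) /\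
  1 / 2 <= cnorm (cexp (w * (z - p))) <= 2).
Proof.
have w1 : 0 < cnorm w + 1 by rewrite ltr_wpDl ?cnorm_ge0.
(* [w] may vanish, hence [cnorm w + 1]. *)
exists (1 / 8 / (cnorm w + 1)) => [|z _ zd]; first by rewrite !divr_gt0.
have v8 : cnorm (w * (z - p)) <= 1 / 8.
  rewrite ler_pdivlMr // in zd; rewrite cnormM mulrC.
  by apply: le_trans zd; rewrite ler_wpM2l ?cnorm_ge0 // lerDl.
have [h1 _] := cexp_near1 v8; rewrite -mulrA -cnormM; split=> //.
have := cnormD (cexp (w * (z - p)) - 1) 1; rewrite subrK cnorm1.
have := cnormD (1 - cexp (w * (z - p))) (cexp (w * (z - p))).
rewrite subrK cnorm1 cnormBC => h2 h3.
by apply/andP; split; lra.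
Qed.

(** If [r] is the value at [p], the lower bound in [cexp_near1] isolates this zero; otherwise
    continuity keeps the exponential away from [r]. *)
Lemma eventually_near_cexp_neq p w r : w != 0 ->
  eventually_near p (fun z => cexp (w * z) - r != 0).
Proof.
move=> w0; set P := cexp (w * p); have P0 : 0 < cnorm P by rewrite cnorm_gt0 cexp_neq0.
have zE z : cexp (w * z) = P * cexp (w * (z - p)).
  by rewrite -cexpD; congr cexp; ring.
have W0 : 0 < cnorm w by rewrite cnorm_gt0.
have [rP|rP] := eqVneq r P.
  exists (1 / 8 / cnorm w) => [|z zp zd]; first by rewrite !divr_gt0.
  have v8 : cnorm (w * (z - p)) <= 1 / 8.
    by rewrite ler_pdivlMr // in zd; rewrite cnormM mulrC.
  have [_ h] := cexp_near1 v8; rewrite rP zE -{2}[P]mulr1 -mulrBr -cnorm_gt0.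
  rewrite cnormM mulr_gt0 //; apply: lt_le_trans h.
  by rewrite divr_gt0 // cnorm_gt0 mulf_neq0 // subr_eq0.
have d0 : 0 < cnorm (r - P) by rewrite cnorm_gt0 subr_eq0.
have near : eventually_near p (fun z => cnorm (z - p) <
    cnorm (r - P) / (2 * cnorm w * cnorm P)).
  exists (cnorm (r - P) / (2 * cnorm w * cnorm P) / 2) => [|z _ zd].
    by rewrite !divr_gt0 // !mulr_gt0.
  apply: le_lt_trans zd _; rewrite ltr_pdivrMr // ltr_pMr ?ltr1n //.
  by rewrite divr_gt0 // !mulr_gt0.
have [d d_gt0 hd] := eventually_near_and near (eventually_near_cexp p w).
exists d => // z zp zd; have [h1 [h2 _]] := hd z zp zd.
apply/negP => /eqP; rewrite zE => e.
have : r - P = P * (cexp (w * (z - p)) - 1).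
  by rewrite mulrBr mulr1; congr (_ - _); apply/eqP; rewrite eq_sym -subr_eq0 e.
move/(congr1 (@cnorm R)); rewrite cnormM => e'.
rewrite ltr_pdivlMr in h1; last by rewrite !mulr_gt0.
have : cnorm (r - P) <= cnorm (z - p) * (2 * cnorm w * cnorm P).
  rewrite e' mulrC [leRHS]mulrA ler_wpM2r ?cnorm_ge0 //.
  by rewrite [leRHS]mulrC.
by rewrite leNgt h1.
Qed.

Lemma eventually_near_is_pole f p :
  (forall A : R, eventually_near p (fun z => A <= cnorm (f z))) -> is_pole f p.
Proof.
move=> H; apply/cvgryPge => A; have [d d0 hd] := H A.
rewrite near_withinE; apply/nbhs_ballP; exists d%:C; first by rewrite /= ltcR.
move=> z; rewrite /ball /= => zd zp; apply: hd => //.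
by rewrite -lecR cnormE distrC ltW.
Qed.

(** Near [p] the [i]-th factor of the denominator is at most a constant times [|z - p|], the others
    are bounded, and the numerator, an exponential, keeps half its size. This makes the assumption
    on outside poles applicable to all translates of a shifted part by periods. *)
Lemma schur_integrand_is_pole (n : nat) (lam : 'I_n -> int) (lnx : R[i]) (q : R)
    (i : 'I_n) p : ln q != 0 ->
  cexp ((ln q)%:C * (p - (shifted_part lam i)%:~R)) = 1 ->
  is_pole (schur_integrand lam lnx q) p.
Proof.
set b := ln q => b0 pi1.
have bC : b%:C != 0 by rewrite (inj_eq (@complexI R)).
pose r j := cexp (b%:C * (shifted_part lam j)%:~R).
pose P := cexp (b%:C * p).
have Pr : P = r i.
  rewrite /P -[p](subrK (shifted_part lam i)%:~R) mulrDr cexpD.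
  by rewrite pi1 mul1r.
have P_gt0 : 0 < cnorm P by rewrite cnorm_gt0 cexp_neq0.
have zE z : cexp (b%:C * z) = P * cexp (b%:C * (z - p)).
  by rewrite -cexpD; congr cexp; ring.
pose num z := cexp ((lnx + b%:C) * z).
have num_gt0 : 0 < cnorm (num p) by rewrite cnorm_gt0 cexp_neq0.
have numE z : num z = num p * cexp ((lnx + b%:C) * (z - p)).
  by rewrite -cexpD; congr cexp; ring.
pose M := \prod_(j | j != i) (2 * cnorm P + cnorm (r j)).
have M_gt0 : 0 < M.
  by apply: prodr_gt0 => j _; rewrite ltr_wpDr ?cnorm_ge0 // mulr_gt0.
pose K := cnorm P * (2 * cnorm b%:C) * M.
have K_gt0 : 0 < K by rewrite !mulr_gt0 // cnorm_gt0.
(* At a zero of the denominator the quotient would be [0] by convention, so such points must be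
   excluded near [p]. *)
have neq0 := eventually_near_all
  (fun j => eventually_near_cexp_neq p (r j) bC).
have nearb := eventually_near_cexp p b%:C.
have nearx := eventually_near_cexp p (lnx + b%:C).
apply: eventually_near_is_pole => A.
have nearA : eventually_near p (fun z =>
    cnorm (z - p) * ((`|A| + 1) * K) <= cnorm (num p) / 2).
  have AK : 0 < (`|A| + 1) * K by rewrite mulr_gt0 // ltr_wpDl.
  exists (cnorm (num p) / 2 / ((`|A| + 1) * K)); first by rewrite !divr_gt0.
  by move=> z _; rewrite ler_pdivlMr.
have [d d0 hd] := eventually_near_and (eventually_near_and nearA neq0)
  (eventually_near_and nearb nearx).
exists d => // z zp zd.
have [[hA hz] [[hb1 /andP[_ hb2]] [_ /andP[hx _]]]] := hd z zp zd.
pose D := \prod_j (cexp (b%:C * z) - r j).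
have -> : schur_integrand lam lnx q z = num z / D.
  rewrite /schur_integrand /cpow /num mulrDl cexpD -/b ![z * _]mulrC.
  by congr (_ / _); apply: eq_bigr => j _; rewrite [_ * b%:C]mulrC.
have D_gt0 : 0 < cnorm D by rewrite cnorm_gt0; apply/prodf_neq0 => j _; exact: hz.
have D_le : cnorm D <= K * cnorm (z - p).
  rewrite /D (bigD1 i) //= cnormM /K mulrAC; apply: ler_pM; rewrite ?cnorm_ge0 //.
    rewrite -Pr zE -{2}[P]mulr1 -mulrBr cnormM -mulrA.
    by rewrite ler_wpM2l ?cnorm_ge0.
  have -> : cnorm (\prod_(j | j != i) (cexp (b%:C * z) - r j)) =
      \prod_(j | j != i) cnorm (cexp (b%:C * z) - r j).
    by apply: (big_morph _ (@cnormM R) (@cnorm1 R)).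
  apply: ler_prod => j _; rewrite cnorm_ge0 /=.
  apply: le_trans (cnormB _ _) _; rewrite lerD2r zE cnormM mulrC.
  by rewrite ler_wpM2r ?cnorm_ge0.
rewrite cnormM cnormV ler_pdivlMr //.
apply: (@le_trans _ _ (cnorm (num p) / 2)).
  apply: le_trans hA; apply: (@le_trans _ _ ((`|A| + 1) * (K * cnorm (z - p)))).
    apply: (@le_trans _ _ ((`|A| + 1) * cnorm D)).
      rewrite ler_wpM2r ?cnorm_ge0 //; have := ler_norm A; lra.
    by rewrite ler_wpM2l // addr_ge0.
  by rewrite mulrA mulrC.
by rewrite (numE z) cnormM ler_wpM2l ?cnorm_ge0 // -[2^-1]div1r.
Qed.

End poles.

(** * Summation of the residues *)

Unset Implicit Arguments.
Set Strict Implicit.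
Set Printing Implicit Defensive.

Theorem theorem3p6 (R : realType) (N : nat) (lam : 'I_N -> int)
  (q : R) (x lnx : R[i]) (c : R -> R[i])
  (N_gt0 : (0 < N)%N)
  (q_gt0 : 0 < q) (q_neq1 : q != 1)
  (lam_sig : is_signature lam)
  (x_neq0 : x != 0)
  (x_neq_pow : forall i : nat, (i < N.-1)%N -> x != q%:C ^+ i)
  (lnxE : cexp lnx = x)
  (c_closed : closed_contour c)
  (c_in : forall i : 'I_N, encloses c (shifted_part lam i)%:~R)
  (c_out : forall p : R[i], is_pole (schur_integrand lam lnx q) p ->
     (forall i : 'I_N, p != (shifted_part lam i)%:~R) -> leaves_outside c p) :
  normalized_schur lam x q%:C =
    qfact q%:C N.-1 * q%:C ^+ 'C(N.-1, 2) * (q%:C - 1) ^+ N.-1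
      / \prod_(1 <= i < N) (x - q%:C ^+ i.-1)
    * ((ln q)%:C / two_pi_i R
       * contour_integral c (schur_integrand lam lnx q)).
Proof.
case: N => [//|n] in lam N_gt0 lam_sig x_neq_pow c_in c_out *.
pose b := ln q; pose L i := shifted_part lam i.
have b0 : b != 0 by rewrite ln_eq0.
have bC : b%:C != 0 by rewrite (inj_eq (@complexI R)).
have intC (k : int) : k%:~R = (k%:~R : R)%:C by rewrite rmorph_int.
have expqb (k : int) : cexp (b%:C * k%:~R) = q%:C ^ k.
  by rewrite mulrzr cexpMz cexp_real lnK ?posrE.
(* The shift turns the weak inequalities of the signature into strict ones. *)
have L_inj i j : i != j -> L i != L j.
  wlog ij : i j / (i < j)%N => [H|_].
    case: (ltngtP i j) => [/H //|/H + ij|/val_inj ->]; last by rewrite eqxx.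
    by rewrite eq_sym [L i == _]eq_sym; exact.
  have := lam_sig _ _ (ltnW ij); rewrite /L /shifted_part => le_lam.
  by have := ltn_ord j; lia.
have q0 : q%:C != 0 by rewrite (inj_eq (@complexI R)) gt_eqF.
have qC_inj (k m : int) : q%:C ^ k = q%:C ^ m -> k = m.
  rewrite -!(rmorphXz (real_complex R)) ?unitfE ?gt_eqF //.
  by move/(@complexI R); exact: ieexprIz.
have qL_inj i j : i != j -> q%:C ^ L i != q%:C ^ L j.
  by move=> /L_inj; apply: contra_neq => /qC_inj.
rewrite normalized_schur_sum //; last first.
  move=> m /andP[m0 _]; rewrite !exprnP -(expr0z q%:C); apply/negP => /eqP /qC_inj.
  by case: m m0.
congr (_ * _).
pose I p := contour_integral c (fun z => (z - p)^-1).
have two_pi0 : two_pi_i R != 0.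
  by rewrite eq_complex /= eqxx /= mulf_neq0 ?pnatr_eq0 // gt_eqF ?pi_gt0.
have IL i : I (L i)%:~R = two_pi_i R.
  have [_] := c_in i; rewrite /winding_number => /(congr1 ( *%R (two_pi_i R))).
  by rewrite mulVKf // mulr1.
have polesL i p : cexp (b%:C * (p - (L i)%:~R)) = 1 ->
    off_contour c p /\ (p != (L i)%:~R -> I p = 0).
  move=> pL; have [->|pLi] := eqVneq p (L i)%:~R.
    by split=> //; have [] := c_in i.
  have [|off w0] := c_out p (schur_integrand_is_pole lnx b0 pL).
    (* If [p] were some [L j], then [q ^ L j = q ^ L i] and injectivity of the powers would give
       [p = L i]. *)
    move=> j; apply: contra_neq pLi => pj; rewrite pj.
    move: pL; rewrite pj mulrBr cexpD cexpN !expqb => e.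
    have /qC_inj : q%:C ^ L j = q%:C ^ L i.
      by rewrite -[LHS]mulr1 -(mulVf (expfz_neq0 (L i) q0)) mulrA e mul1r.
    exact: (congr1 (fun k : int => k%:~R)).
  split=> // _; move: w0; rewrite /winding_number => /eqP.
  by rewrite mulf_eq0 invr_eq0 (negPf two_pi0) => /eqP.
have off t i : t \in `[0, 1] -> cexp (b%:C * c t) != q%:C ^ L i.
  move=> t01; apply/negP => /eqP e.
  have [|/(_ t t01)] := polesL i (c t); last by rewrite eqxx.
  by rewrite mulrBr cexpD cexpN expqb e mulfV // expfz_neq0.
pose k i := (\prod_(j < n.+1 | j != i) (q%:C ^ L i - q%:C ^ L j))^-1.
have Hi i : has_cint c
    (fun z => k i * (cexp (lnx * z) / (1 - cexp (- (b%:C * (z - (L i)%:~R))))))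
    (k i * (x ^ L i / b%:C * two_pi_i R)).
  apply: has_cintZ; rewrite -(IL i).
  have -> : x ^ L i = cexp (lnx * (L i)%:~R) by rewrite mulrzr cexpMz lnxE.
  (* The centres [L i] are real, so the height is [0] and its bound is trivial. *)
  have := @residue_formulaT R c lnx (L i)%:~R c_closed b b0 0.
  rewrite complexr0 -intC; apply.
  - by rewrite mulr0 normr0 pi_ge0.
  - by move=> p /polesL [].
  - by move=> p /polesL [].
have [_ _ ] : has_cint c (schur_integrand lam lnx q)
    (\sum_i k i * (x ^ L i / b%:C * two_pi_i R)).
  apply: eq_has_cint (has_cint_sum c_closed _ Hi) => t t01.
  set z := c t; rewrite /schur_integrand /cpow ![z * _]mulrC -/b.
  rewrite [X in _ = _ / X](eq_bigr (fun i => cexp (b%:C * z) - q%:C ^ L i));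
    last by move=> i _; rewrite [_ * b%:C]mulrC expqb.
  rewrite inv_prod_partial_fractions //; last by move=> i; exact: off.
  rewrite mulr_sumr; apply: eq_bigr => i _.
  (* With [w] the value of [q ^ z], the numerator turns each fraction into the kernel:
     [w / (w - r) = 1 / (1 - r / w)]. *)
  rewrite mulrBr opprB cexpD cexpN expqb -/(k i).
  have E0 := cexp_neq0 (b%:C * z).
  have := off t i t01; rewrite -/z -subr_eq0; move: E0.
  move: (cexp (b%:C * z)) (q%:C ^ L i) => E r E0 Er.
  by field; rewrite E0 Er.
move=> ->; rewrite mulr_sumr; apply: eq_bigr => i _.
by rewrite -/(k i); field; rewrite two_pi0 andbT -[X in X != 0]/(b%:C).
Qed.
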